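(* For every prime number $n\ge 7$ there exist coprime integers $k\ge 2$, $l\ge 3$ with $k+l=n$ such that, for every regular language $L$ over an alphabet of size $2$ with $\mathrm{sc}(L)\le n$, $$\mathrm{sc}(\mathrm{root}(L))\le |U_{k,l}|-\binom n2 .$$ Furthermore, this bound is tight: there exists a regular language $L$ over an alphabet of size $2$ with $\mathrm{sc}(L)\le n$ and $\mathrm{sc}(\mathrm{root}(L))=|U_{k,l}|-\binom n2$.
   Context: For a language $L\subseteq\Sigma^*$ over a finite alphabet $\Sigma$, $\mathrm{root}(L)=\{w\in\Sigma^* : \exists n\ge 1 \text{ such that } w^n\in L\}$. The state complexity $\mathrm{sc}(L)$ of a regular language $L\subseteq\Sigma^*$ is the number of states of the smallest DFA over $\Sigma$ (with total transition function) recognizing $L$. Let $Z_n=\{1,\dots,n\}$ and let $T_n$ be the monoid of all functions $Z_n\to Z_n$ with composition $(fg)(z)=g(f(z))$. For coprime integers $k,l\ge 2$ with $k+l=n$, let $\alpha=(1\ 2\ \cdots\ k)(k+1\ \ k+2\ \cdots\ n)$, a permutation of $Z_n$ with one cycle of length $k$ and one of length $l$. $U_{k,l}\subseteq T_n$ is the set of all $\gamma\in T_n$ for which exactly one of the following holds: (1) $\gamma=\alpha^m$ for some positive integer $m$; (2) there are $i\in\{1,\dots,k\}$ and $j\in\{k+1,\dots,n\}$ with $\gamma(i)=\gamma(j)$, and there is $m\in\{k+1,\dots,n\}$ not in the image of $\gamma$. *)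

(* Defs.v *)
From mathcomp Require Import all_boot.
From mathcomp Require Import boolp.

Set Implicit Arguments.
Unset Strict Implicit.
Unset Printing Implicit Defensive.

Definition language (Sigma : finType) := seq Sigma -> Prop.

Definition root_lang (Sigma : finType) (L : language Sigma) : language Sigma :=
  fun w => exists n : nat, 1 <= n /\ L (flatten (nseq n w)).

Record dfa (Sigma : finType) := Dfa {
  dfa_state : finType;
  dfa_start : dfa_state;
  dfa_final : pred dfa_state;
  dfa_trans : dfa_state -> Sigma -> dfa_state }.

Definition recognizes (Sigma : finType) (M : dfa Sigma) (L : language Sigma) :=
  forall w, L w <-> dfa_final (foldl (@dfa_trans _ M) (dfa_start M) w).

Definition regular (Sigma : finType) (L : language Sigma) :=
  exists M : dfa Sigma, recognizes M L.

Definition recognized_with (Sigma : finType) (L : language Sigma) (m : nat) :=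
  exists2 M : dfa Sigma, recognizes M L & #|dfa_state M| = m.

Lemma ex_recognized_with (Sigma : finType) (L : language Sigma) :
  regular L -> exists m, `[< recognized_with L m >].
Proof. by case=> M ML; exists #|dfa_state M|; apply/asboolP; exists M. Qed.

(* Restricted to regular languages so that no default value is involved; the
   value does not depend on the regularity proof. *)
Definition sc (Sigma : finType) (L : language Sigma) (hL : regular L) : nat :=
  ex_minn (ex_recognized_with hL).
Arguments sc {Sigma} L hL.

Lemma regular_root (Sigma : finType) (L : language Sigma) :
  regular L -> regular (root_lang L).
Proof.
case=> -[Q q0 F d] ML.
pose tr (f : {ffun Q -> Q}) a := [ffun q => d (f q) a].
pose fin (f : {ffun Q -> Q}) := `[< exists n, 1 <= n /\ F (iter n f q0) >].
exists (Dfa [ffun q => q] fin tr) => w /=.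
have trE u f q : foldl tr f u q = foldl d (f q) u.
  by elim: u f => //= a u IHu f; rewrite IHu ffunE.
have itE n q : iter n (foldl tr [ffun q => q] w) q
             = foldl d q (flatten (nseq n w)).
  elim: n q => //= n IHn q.
  by rewrite -iterS iterSr IHn trE ffunE foldl_cat.
split=> [[n [n1 Ln]]|/asboolP[n [n1 Fn]]].
  by apply/asboolP; exists n; split=> //; rewrite itE; apply/ML.
by exists n; split=> //; apply/ML; rewrite /= -itE.
Qed.

(* Points are numbered from 0: the image of [lshift l : 'I_k -> 'I_(k + l)]
   stands for {1, ..., k}, that of [rshift k : 'I_l -> 'I_(k + l)] for
   {k + 1, ..., n}, where n = k + l. *)
Definition alpha (k l : nat) (z : 'I_(k + l)) : 'I_(k + l) :=
  match split z with
  | inl i => lshift l (ordS i)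
  | inr j => rshift k (ordS j)
  end.

Definition is_alpha_power (k l : nat) (g : {ffun 'I_(k + l) -> 'I_(k + l)}) :=
  exists m : nat, 0 < m /\ forall z, g z = iter m (@alpha k l) z.

Definition merges_and_misses (k l : nat)
    (g : {ffun 'I_(k + l) -> 'I_(k + l)}) :=
  (exists (i : 'I_k) (j : 'I_l), g (lshift l i) = g (rshift k j)) /\
  (exists m : 'I_l, forall z, g z <> rshift k m).

(* [(+)] is exclusive or. *)
Definition U (k l : nat) : {set {ffun 'I_(k + l) -> 'I_(k + l)}} :=
  [set g | `[< is_alpha_power g >] (+) `[< merges_and_misses g >]].

(* Main.v *)
Require Import Defs.
From mathcomp Require Import all_boot all_fingroup zify boolp.

(* The words over the alphabet act on the n states, and the reachable states of
   the automaton of root(L) are the elements of the generated monoid W, so the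
   task is to find the largest two-generated W and the states that always merge.

   Upper bound.  Compare with (k, l) maximizing |U_{k,l}|.  If both letters are
   permutations, or none is, W is small.  Otherwise one letter is a permutation
   s and the other merges a and b and misses m; every f in W is a power of s, or
   merges two points of the s-orbit of the pair {a, b} and misses a point of the
   s-orbit of m.  If a and b lie in one cycle of s, proper colourings of a graph
   of degree at most 2 show that W is too small.  If they lie in different cycles
   and s has further cycles, W misses enough elements of a conjugate of U_{k,l};
   if s has exactly two cycles, W is contained in a conjugate of U_{k,l}, and
   at least n choose 2 elements of it are redundant: for a point x depending on
   the final states, the map x -> b, rest -> a behaves like x -> a, rest -> b (if
   the start state is final, with x the start state) or like the constant a (if
   x is final and the start state is not).

   Tightness.  U_{k,l} is generated by alpha and a suitable second map, and when
   the start state is the only final state, distinct elements of U_{k,l} that are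
   not related as above are distinguished by an element of U_{k,l} of rank 2. *)

Set Implicit Arguments.
Unset Strict Implicit.
Unset Printing Implicit Defensive.

(** * Automata and transformations *)

(** The attained values of [c] serve as states, and transitions and finality are read off one chosen
    representative word per value. Only equality of residuals is asked of words with the same value;
    [c] need not be compatible with appending letters, so redundant transformations may be collapsed
    one by one. *)
Lemma sc_le_card (Sigma : finType) (K : language Sigma) (hK : regular K)
    (X : finType) (S : {set X}) (c : seq Sigma -> X) :
  (forall u, c u \in S) ->
  (forall u v, c u = c v -> forall w, K (u ++ w) <-> K (v ++ w)) ->
  sc K hK <= #|S|.
Proof.
move=> cS cK.
pose R := [set x in S | `[< exists u, c u = x >]].
have Rc u : c u \in R by rewrite inE cS; apply/asboolP; exists u.
have repP (x : {x | x \in R}) : exists u, c u = val x.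
  by case: x => x /= /[!inE] /andP[_ /asboolP].
pose rep x := projT1 (cid (repP x)).
have repK x : c (rep x) = val x by rewrite /rep; case: cid.
pose q u : {x | x \in R} := exist _ (c u) (Rc u).
pose M := @Dfa Sigma {x | x \in R} (q [::]) (fun x => `[< K (rep x) >])
            (fun x a => q (rcons (rep x) a)).
have run w x u : c u = val x -> K (u ++ w) <->
    dfa_final (foldl (@dfa_trans _ M) x w).
  elim: w x u => [|a w IH] x u cu /=.
    have H := cK u (rep x); rewrite repK cu in H.
    have {H} := H erefl [::]; rewrite !cats0 => H; split.
      by move=> /H h; apply/asboolP.
    by move=> /asboolP /H.
  rewrite -(IH _ (rcons (rep x) a)) // cat_rcons.
  by apply: cK; rewrite repK.
have MK : recognizes M K by move=> w; apply: (run w _ [::]).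
rewrite /sc; case: ex_minnP => m _ min.
apply: (leq_trans (min #|dfa_state M| _)).
  by apply/asboolP; exists M.
rewrite card_sig subset_leq_card //.
by apply/subsetP => x; rewrite !inE => /andP[].
Qed.

(** Words with different residuals lead every automaton for [K] to different states. *)
Lemma card_le_sc (Sigma : finType) (K : language Sigma) (hK : regular K)
    (X : finType) (S : {set X}) (word : X -> seq Sigma) :
  {in S &, forall x y, (forall w, K (word x ++ w) <-> K (word y ++ w)) -> x = y} ->
  #|S| <= sc K hK.
Proof.
move=> inj; rewrite /sc; case: ex_minnP => m /asboolP[M MK <-] _.
pose q x := foldl (@dfa_trans _ M) (dfa_start M) (word x).
rewrite -(@card_in_imset _ _ q S) ?max_card // => x y xS yS exy.
by apply: inj => // w; rewrite !MK !foldl_cat -/(q x) -/(q y) exy.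
Qed.

Lemma sc_le_states (Sigma : finType) (K : language Sigma) (hK : regular K)
    (M : dfa Sigma) : recognizes M K -> sc K hK <= #|dfa_state M|.
Proof.
move=> MK; rewrite /sc; case: ex_minnP => m _; apply.
by apply/asboolP; exists M.
Qed.

Section Action.
Variables (T Sigma : finType) (d : T -> Sigma -> T).

Definition act (u : seq Sigma) : {ffun T -> T} := [ffun z => foldl d z u].

(** Membership in the root, read off the transformation of a word; [m.+1] is the exponent, which
    must be positive. *)
Definition accepts (q0 : T) (F : pred T) (f : T -> T) :=
  exists m, F (iter m.+1 f q0).

Lemma act_cat u v z : act (u ++ v) z = act v (act u z).
Proof. by rewrite !ffunE foldl_cat. Qed.

Lemma act_rcons u a : act (rcons u a) = [ffun z => d (act u z) a].
Proof. by apply/ffunP => z; rewrite !ffunE -cats1 foldl_cat. Qed.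

Lemma root_lang_accepts (L : language Sigma) q0 (F : pred T) :
  (forall w, L w <-> F (foldl d q0 w)) ->
  forall u, root_lang L u <-> accepts q0 F (act u).
Proof.
move=> LF u.
have itE m : foldl d q0 (flatten (nseq m u)) = iter m (act u) q0.
  elim: m q0 {LF} => //= m IH q; rewrite foldl_cat IH -iterS iterSr.
  by rewrite [act u q]ffunE.
split=> [[[|m] [// _ /LF]]|[m Fm]]; first by rewrite itE; exists m.
by exists m.+1; split=> //; apply/LF; rewrite itE.
Qed.

Lemma eq_accepts q0 F f g : f =1 g -> accepts q0 F f -> accepts q0 F g.
Proof. by move=> fg [m]; exists m; rewrite -(eq_iter fg). Qed.

Variables (L : language Sigma) (hL : regular L) (q0 : T) (F : pred T).
Hypothesis LF : forall w, L w <-> F (foldl d q0 w).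

(** Appending a word composes its action afterwards, so two transformations accepted alike after
    every [h] have the same residual; the elements of [D] then need no states of their own. *)
Lemma sc_root_le (W D : {set {ffun T -> T}}) (kappa : {ffun T -> T} -> {ffun T -> T}) :
  (forall u, act u \in W) -> D \subset W ->
  {in D, forall f, kappa f \in W :\: D /\
     forall h : {ffun T -> T}, accepts q0 F (h \o f) <-> accepts q0 F (h \o kappa f)} ->
  sc (root_lang L) (regular_root hL) <= #|W| - #|D|.
Proof.
move=> actW DW kD.
rewrite -cardsDS //.
pose c u := if act u \in D then kappa (act u) else act u.
have cE u (h : {ffun T -> T}) : accepts q0 F (h \o act u) <-> accepts q0 F (h \o c u).
  by rewrite /c; case: ifP => // /kD [].
apply: (@sc_le_card _ _ _ _ _ c) => [u|u v cuv w].
  by rewrite /c; case: ifP => [/kD[]//|uD]; rewrite inE uD actW.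
have accE x : root_lang L (x ++ w) <-> accepts q0 F (act w \o act x).
  rewrite (root_lang_accepts LF).
  by split; apply: eq_accepts => z; rewrite act_cat.
by rewrite !accE !cE cuv.
Qed.

End Action.

(** The states of a smallest automaton are embedded into ['I_n]; the remaining points are fixed by
    every letter and not final. *)
Lemma regular_ordinal (Sigma : finType) (L : language Sigma) (hL : regular L) n :
  sc L hL <= n -> exists (d : 'I_n -> Sigma -> 'I_n) q0 (F : pred 'I_n),
    forall w, L w <-> F (foldl d q0 w).
Proof.
rewrite /sc; case: ex_minnP => m /asboolP[M ML <-] _ len.
pose e (q : dfa_state M) : 'I_n := widen_ord len (enum_rank q).
have einj : injective e.
  by move=> p q /(congr1 val) /= /val_inj /enum_rank_inj.
pose p z := [pick q | e q == z].
have pe q : p (e q) = Some q.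
  rewrite /p; case: pickP => [q' /eqP/einj->//|/(_ q)].
  by rewrite eqxx.
exists (fun z a => if p z is Some q then e (dfa_trans q a) else z), (e (dfa_start M)),
  (fun z => if p z is Some q then dfa_final q else false) => w.
rewrite ML; elim: w (dfa_start M) => [|a w IH] q /=; first by rewrite pe.
by rewrite IH pe.
Qed.

(** * Counting functions *)

Lemma leq_card_bigcup (I T : finType) (r : pred I) (F : I -> {set T}) :
  #|\bigcup_(i | r i) F i| <= \sum_(i | r i) #|F i|.
Proof.
elim/big_rec2: _ => [|i m S _ le_S]; first by rewrite cards0.
by rewrite (leq_trans (leq_card_setU _ _).1) // leq_add2l.
Qed.

Lemma card_dep_pairs (I J : finType) (S : {set I}) (r : I -> pred J) :
  #|[set p : I * J | (p.1 \in S) && r p.1 p.2]| = \sum_(i in S) #|r i|.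
Proof.
under eq_bigr do rewrite -sum1_card.
by rewrite pair_big_dep /= -sum1_card; apply: eq_bigl => -[i j]; rewrite inE.
Qed.

Lemma card_family_prod (I J : finType) (F : I -> pred J) :
  #|(family F : simpl_pred {ffun I -> J})| = \prod_i #|F i|.
Proof.
by rewrite (card_family F) foldrE big_map big_enum.
Qed.

Section Counting.
Variable T : finType.
Implicit Types (f g : {ffun T -> T}) (A B P Q : {set T}) (a b m x y z : T).

Definition upd f x v : {ffun T -> T} := [ffun z => if z == x then v else f z].

Lemma updK f x v : upd (upd f x v) x (f x) = f.
Proof. by apply/ffunP => z; rewrite !ffunE; case: eqP => [->|]. Qed.

(** Double counting: a function [f] in [S] with an admissible new value at [x] is encoded
    injectively by the old value [f x] and the updated function. *)
Lemma leq_avoid (S : {set {ffun T -> T}}) x (s : seq T) :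
  (forall f v, f \in S -> upd f x v \in S) -> x \notin s ->
  (#|T| - size s) * #|S| <= #|T| * #|[set f in S | f x \notin map f s]|.
Proof.
move=> Supd xs; set S' := [set f in S | _].
pose X := [set p : {ffun T -> T} * T | (p.1 \in S) && (p.2 \notin map p.1 s)].
have cX : (#|T| - size s) * #|S| <= #|X|.
  rewrite (card_dep_pairs S (fun f v => v \notin map f s)) mulnC -sum_nat_const.
  apply: leq_sum => f _.
  have := cardC (mem (map f s)); rewrite leq_subLR => <-.
  rewrite leq_add2r -(size_map f s); exact: card_size.
apply: (leq_trans cX).
pose h (p : {ffun T -> T} * T) := (p.1 x, upd p.1 x p.2).
have hinj : injective h.
  move=> [f v] [g w] [/= fg e]; have vw : v = w.
    by move/ffunP/(_ x): e; rewrite !ffunE eqxx.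
  by rewrite -vw in e *; rewrite -(updK f x v) e fg updK.
rewrite -(card_imset _ hinj) -[#|T|]cardsT -cardsX.
apply/subset_leq_card/subsetP => _ /imsetP[[f v] /[!inE]/= /andP[fS vs] ->].
rewrite /= Supd //= ffunE eqxx.
suff -> : map (upd f x v) s = map f s by [].
apply/eq_in_map => z zs; rewrite ffunE; case: eqP => // zx.
by rewrite -zx zs in xs.
Qed.

(** Each point added to [s] preserves at least the fraction 1 - 1/|T| of the functions; denominators
    are cleared. *)
Lemma card_avoid_star p (s : seq T) : uniq s -> p \notin s ->
  #|T| ^ #|T| * #|T|.-1 ^ size s <=
  #|T| ^ size s * #|[set f : {ffun T -> T} | all (fun z => f z != f p) s]|.
Proof.
elim: s => [|x s IH] /=.
  by move=> _ _; rewrite mulnC leq_mul2l -card_ffun -cardsT subset_leq_card ?orbT //;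
    apply/subsetP=> f; rewrite inE.
case/andP => xs us; rewrite inE negb_or eq_sym => /andP[xp ps].
have := IH us ps; set S := [set f | _] => IHs.
have := @leq_avoid S x [:: p] _ _; rewrite inE xp => /(_ _ isT) /= H.
have {H} : (#|T| - 1) * #|S| <= #|T| * #|[set f in S | f x \notin [:: f p]]|.
  apply: H => f v; rewrite !inE => /allP fS; apply/allP => z zs; rewrite !ffunE.
  rewrite [p == x]eq_sym (negPf xp).
  have [zx|_] := eqVneq z x; first by rewrite -zx zs in xs.
  exact: fS.
set S' := [set f in S | _]; set S'' := [set f | _] => H.
have -> : S'' = S' by apply/setP => f; rewrite !inE andbC.
rewrite !expnS mulnCA (leq_trans (leq_mul (leqnn _) IHs)) //.
rewrite mulnCA -subn1 (leq_trans (leq_mul (leqnn _) H)) // mulnCA mulnA //.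
Qed.

(* Colour the points of [s] greedily: a point with [e] neighbours coloured
   before keeps at least [#|T| - e] colours, and [e <= 2] gives
   [(#|T| - e) ^ 2 * #|T| ^ e >= #|T| ^ 2 * (#|T| - 2) ^ e]. *)
Lemma card_avoid_cycles (t : {perm T}) (s : seq T) : 1 < #|T| -> uniq s ->
  {in s, forall x, t x != x} ->
  let e := count (fun x => t x \in s) s in
  let S := [set f : {ffun T -> T} | all (fun x => (t x \in s) ==> (f x != f (t x))) s] in
  (#|T| ^ #|T|) ^ 2 * (#|T| - 2) ^ e <= #|T| ^ e * #|S| ^ 2.
Proof.
move=> T1; elim: s => [|x s IH] /=.
  move=> _ _; rewrite !expn0 muln1 mul1n leq_sqr -card_ffun -cardsT subset_leq_card //.
case/andP => xs us tx; have := IH us _ => {}IH.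
have tx1 : t x != x by rewrite tx ?mem_head.
have {}IH := IH (fun y ys => tx y (mem_behead (s := x :: s) ys)).
move: IH => /=; set e := count _ s; set S := [set f | _] => IH.
set e' := count _ s; set S' := [set f | _].
(* [L] lists the neighbours of [x] that are already coloured. If [t] exchanges two points, the
   neighbour is listed twice, in accordance with the directed edges counted by [e]. *)
pose L := (if t x \in s then [:: t x] else [::]) ++
          (if (t^-1)%g x \in s then [:: (t^-1)%g x] else [::]).
have xL : x \notin L.
  rewrite mem_cat negb_or; apply/andP; split.
    by case: ifP; rewrite // inE eq_sym.
  case: ifP; rewrite // inE => h; apply: contra xs => /eqP xE; by rewrite {1}xE.
have := @leq_avoid S x L _ xL.
have Supd f v : f \in S -> upd f x v \in S.
  rewrite !inE => /allP fS; apply/allP => z zs; apply/implyP => tzs.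
  have := fS z zs; rewrite tzs /= !ffunE.
  have [zx|_] := eqVneq z x; first by rewrite -zx zs in xs.
  by have [zx|_] := eqVneq (t z) x; first by rewrite -zx tzs in xs.
move=> /(_ Supd).
have -> : [set f in S | f x \notin map f L] = S'.
  apply/setP => f; rewrite !inE /= (negPf tx1) /= map_cat mem_cat negb_or.
  apply/idP/idP.
    move=> /and3P[/allP fS f1 f2]; apply/andP; split.
      by apply/implyP => txs; move: f1; rewrite txs inE.
    apply/allP => z zs; apply/implyP; rewrite inE => /orP[/eqP tz|tzs].
      move: f2; rewrite -{1 2}tz permK zs /= inE tz -{2}tz permK; by rewrite eq_sym.
    by have := fS z zs; rewrite tzs.
  move=> /andP[f1 /allP f2]; apply/and3P; split.
  - by apply/allP => z zs; apply/implyP => tzs; have := f2 z zs; rewrite inE tzs orbT.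
  - by case: ifP f1 => //= _; rewrite inE.
  - case: ifP => //= h; have := f2 _ h; rewrite inE permKV eqxx /= inE.
    by rewrite eq_sym.
have e'E : (t x \in x :: s) + e' = size L + e.
  rewrite inE (negPf tx1) /= size_cat -addnA; congr addn; first by case: ifP.
  have -> : e' = count (fun y => t y == x) s + e.
    rewrite /e' /e -[RHS]count_predUI; set c := count (predI _ _) s.
    have -> : c = 0.
      apply/eqP; rewrite -leqn0 leqNgt -has_count; apply/hasPn => y ys /=.
      by apply/negP => /andP[/eqP->]; apply/negP.
    by rewrite addn0; apply: eq_count => y; rewrite !inE.
  congr addn.
  rewrite (eq_count (a2 := pred1 ((t^-1)%g x))) ?count_uniq_mem //; first by case: ifP.
  by move=> y /=; rewrite (canF_eq (permK t)).
rewrite e'E => H.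
have : size L <= 2 by rewrite /L; do 2!case: ifP.
rewrite !expnD; set n := #|T| in T1 H IH *.
set N := n ^ n in IH *.
set w := size L in H *.
set E1 := (n - 2) ^ e in IH *; set E2 := n ^ e in IH *; set a := #|S| in IH H *; set b := #|S'| in H *.
clearbody N E1 E2 w a b.
have {}H : ((n - w) * a) ^ 2 <= (n * b) ^ 2 by rewrite leq_sqr.
move=> w2; have Hw : n ^ 2 * (n - 2) ^ w <= (n - w) ^ 2 * n ^ w.
  by case: w w2 {H} => [|[|[|]]] // _; rewrite ?subn0 ?expn0 ?expn1; nia.
have n2 : 0 < n ^ 2 by rewrite expn_gt0; lia.
rewrite -(leq_pmul2l n2).
have -> : n ^ 2 * (N ^ 2 * ((n - 2) ^ w * E1)) = (n ^ 2 * (n - 2) ^ w) * (N ^ 2 * E1).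
  by lia.
apply: (leq_trans (leq_mul Hw IH)).
have -> : (n - w) ^ 2 * n ^ w * (E2 * a ^ 2) = n ^ w * E2 * ((n - w) * a) ^ 2.
  by rewrite expnMn; lia.
by rewrite [leqRHS]mulnCA leq_mul2l -expnMn H orbT.
Qed.
Lemma card_misses q : #|[set f : {ffun T -> T} | q \notin codom f]| = #|T|.-1 ^ #|T|.
Proof.
rewrite -(cardC1 q) -card_ffun_on; apply: eq_card => f; rewrite inE.
apply/idP/ffun_onP => [h x|h]; first by apply: contraNneq h => <-; apply: codom_f.
by apply/negP => /codomP[x qE]; have := h x; rewrite inE -qE eqxx.
Qed.

(** Once the values at [p0] and [p1] are fixed, every other point has |T| - 1 choices if they
    coincide and |T| - 2 otherwise. *)
Lemma card_disjoint_pair (p0 p1 : T) : p0 != p1 ->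
  #|[set f : {ffun T -> T} | [forall z in [set~ p0] :\ p1, (f z != f p0) && (f z != f p1)]]|
  <= #|T| * (#|T|.-1 ^ (#|T| - 2) + #|T|.-1 * (#|T| - 2) ^ (#|T| - 2)).
Proof.
move=> p01; set S := [set f | _].
pose F (u v z : T) : pred T :=
  if z == p0 then pred1 u else if z == p1 then pred1 v else mem (~: [set u; v]).
have SF : S \subset \bigcup_(u : T) \bigcup_(v : T) [set f | f \in family (F u v)].
  apply/subsetP => f; rewrite inE => /forall_inP fS.
  apply/bigcupP; exists (f p0) => //; apply/bigcupP; exists (f p1) => //.
  rewrite inE; apply/familyP => z; rewrite /F.
  case: eqP => [->|/eqP z0]; first by rewrite inE.
  case: eqP => [->|/eqP z1]; first by rewrite inE.
  by rewrite !inE negb_or fS // !inE z1 z0.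
apply: (leq_trans (subset_leq_card SF)).
apply: (leq_trans (leq_card_bigcup _ _)).
rewrite -sum_nat_const; apply: leq_sum => u _.
apply: (leq_trans (leq_card_bigcup _ _)).
have cF v : #|[set f | f \in family (F u v)]| = (#|T| - (u != v).+1) ^ (#|T| - 2).
  rewrite cardsE card_family_prod (bigD1 p0) //= (bigD1 p1 (P := fun z => z != p0)) /=; last by rewrite eq_sym.
  rewrite /F eqxx card1 mul1n [p1 == p0]eq_sym (negPf p01) eqxx card1 mul1n.
  rewrite (eq_bigr (fun=> #|T| - (u != v).+1)) => [|z /andP[/negPf-> /negPf->]]; last first.
    by rewrite cardsCs setCK cards2.
  rewrite prod_nat_const; congr expn.
  rewrite -(cardC (pred2 p0 p1)) card2 p01 addKn; apply: eq_card => z.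
  by rewrite !inE negb_or.
under eq_bigr do rewrite cF.
rewrite (bigD1 u) //= eqxx subn1 leq_add2l -(cardC1 u) -sum_nat_const.
rewrite [X in _ <= X](eq_bigl (fun v => v != u)) //; apply: leq_sum => v vu.
by rewrite eq_sym vu.
Qed.

(* A function [f] with [f i = f j] hitting all points outside [{i, i'}] arises
   from a permutation fixing [i], by changing its values at two points. *)
Lemma card_merging_onto (i i' j : T) : i != i' -> j != i ->
  #|[set f : {ffun T -> T} | (f i == f j) &&
      [forall m in [set~ i] :\ i', m \in codom f]]| <= #|T|`!.
Proof.
move=> ii' ji; set S := [set f | _].
pose h (p : {perm T} * T) z := if (p.1^-1)%g z == i' then p.2 else (p.1^-1)%g z.
pose H p : {ffun T -> T} := [ffun z => if z == i then h p j else h p z].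
pose D := setX [set s | perm_on [set~ i] s] [set: T].
suff SH : S \subset H @: D.
  apply: (leq_trans (subset_leq_card SH)); apply: (leq_trans (leq_imset_card _ _)).
  rewrite cardsX cardsT cardsE card_perm cardsC1.
  have : 0 < #|T| by apply/card_gt0P; exists i.
  by case: #|T| => //= n _; rewrite factS mulnC.
apply/subsetP => f; rewrite inE => /andP[/eqP fij /forall_inP onto].
(* [g] chooses a preimage different from [i]; it exists because [j] can replace [i]. *)
pose g m := if [pick z | (z != i) && (f z == m)] is Some z then z else m.
have gP m : m \in [set~ i] :\ i' -> g m != i /\ f (g m) = m.
  move=> mP; rewrite /g; case: pickP => [z /andP[? /eqP]//|no].
  have /codomP[z mE] := onto _ mP.
  have [zi|zi] := eqVneq z i; last by have := no z; rewrite zi mE eqxx.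
  by have := no j; rewrite ji mE zi fij eqxx.
have [e ei eg] : exists2 e, e != i & e \notin g @: ([set~ i] :\ i').
  have /card_gt0P[e] : 0 < #|~: (i |: g @: ([set~ i] :\ i'))|.
    rewrite cardsCs setCK subn_gt0 cardsU1.
    apply: (@leq_ltn_trans (1 + #|[set~ i] :\ i'|)).
      by apply: leq_add; [case: (_ \notin _) | apply: leq_imset_card].
    have := cardsD1 i' [set~ i]; rewrite !inE eq_sym ii' cardsC1 => <-.
    by rewrite prednK //; apply/card_gt0P; exists i.
  by rewrite !inE negb_or => /andP[? ?]; exists e.
(* This is a permutation whose inverse agrees with [f] off [i] and the left-over point [e]; at [e]
   the inverse gives [i'], and [f e] is recorded separately. *)
pose r z := if z == i then i else if z == i' then e else g z.
have notP z : (z == i) = false -> (z == i') = false -> z \in [set~ i] :\ i'.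
  by move=> zi zi'; rewrite !inE zi zi'.
have rinj : injective r.
  move=> x y; rewrite /r.
  case: (x =P i) => [->|/eqP/negPf xi]; case: (y =P i) => [->|/eqP/negPf yi] //.
  - by case: ifP => [_ E|yi' E]; [rewrite -E eqxx in ei | case: (gP y (notP _ yi yi')); rewrite -E eqxx].
  - by case: ifP => [_ E|xi' E]; [rewrite E eqxx in ei | case: (gP x (notP _ xi xi')); rewrite E eqxx].
  case: (x =P i') => [->|/eqP/negPf xi']; case: (y =P i') => [->|/eqP/negPf yi'] //.
  - by move=> E; rewrite E imset_f ?notP in eg.
  - by move=> E; rewrite -E imset_f ?notP in eg.
  - move=> E; have [_ <-] := gP x (notP _ xi xi'); have [_ <-] := gP y (notP _ yi yi').
    by rewrite E.
pose s := perm rinj.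
have si : s i = i by rewrite permE /r eqxx.
have hf z : z != i -> h (s, f e) z = f z.
  rewrite /h /= -[in z != i](permKV s z) -[in RHS](permKV s z).
  move: ((s^-1)%g z) => w swi; case: eqP => [->|/eqP/negPf wi'].
    by rewrite permE /r eq_sym (negPf ii') eqxx.
  have wi : (w == i) = false by apply: contraNF swi => /eqP->; rewrite si.
  by rewrite permE /r wi wi'; case: (gP _ (notP _ wi wi')).
apply/imsetP; exists (s, f e).
  rewrite !inE andbT; apply/subsetP => z; rewrite !inE.
  by apply: contraNneq => ->; rewrite si.
apply/ffunP => z; rewrite ffunE.
by case: (z =P i) => [->|/eqP zi]; rewrite hf.
Qed.

Lemma card_slack (X : {set T}) c m r y : r \notin X -> y != r -> c != m ->
  (#|T| - 2) ^ (#|T| - #|X| - 1) <=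
  #|[set f : {ffun T -> T} | [&& [forall z in X, f z == c], f r == f y &
       [forall z, (z \notin X) && (z != r) ==> (f z != c)]] && (m \notin codom f)]|.
Proof.
move=> rX yr cm.
pose F z : pred T := if (z \in X) || (z == r) then pred1 c else mem (~: [set c; m]).
pose h f := upd f r (f y).
have cF : #|[set f : {ffun T -> T} | f \in family F]| = (#|T| - 2) ^ (#|T| - #|X| - 1).
  rewrite cardsE card_family_prod (bigID (fun z => (z \in X) || (z == r))) /=.
  rewrite big1 => [|z zX]; last by rewrite /F zX card1.
  rewrite mul1n (eq_bigr (fun=> #|T| - 2)) => [|z /negPf zX]; last first.
    by rewrite /F zX cardsCs setCK cards2 cm.
  rewrite prod_nat_const; congr expn.
  have -> : #|T| - #|X| - 1 = #|T| - #|r |: X| by rewrite cardsU1 rX; lia.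
  rewrite -(cardsC (r |: X)) addKn; apply: eq_card => z; rewrite !inE.
  by rewrite orbC.
rewrite -cF -(@card_in_imset _ _ h).
  apply/subset_leq_card/subsetP => _ /imsetP[f /[!inE] /familyP fF ->].
  have fX z : z \in X -> f z = c.
    by move=> zX; have := fF z; rewrite /F zX inE => /eqP.
  have fN z : z \notin X -> z != r -> (f z != c) && (f z != m).
    by move=> /negPf zX /negPf zr; have := fF z; rewrite /F zX zr !inE negb_or.
  have fm z : z != r -> f z != m.
    move=> zr; have [zX|zX] := boolP (z \in X); first by rewrite fX.
    by have /andP[] := fN z zX zr.
  apply/andP; split; first apply/and3P; first split.
  - apply/forall_inP => z zX; rewrite ffunE; have [zr|_] := eqVneq z r; last by rewrite fX.
    by rewrite -zr zX in rX.
  - by rewrite !ffunE eqxx (negPf yr).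
  - apply/forallP => z; apply/implyP => /andP[zX zr]; rewrite ffunE (negPf zr).
    by have /andP[] := fN z zX zr.
  - apply/codomP => -[z]; rewrite ffunE; case: (eqVneq z r) => [_|zr] /eqP.
      by rewrite eq_sym (negPf (fm y yr)).
    by rewrite eq_sym (negPf (fm z zr)).
move=> f1 f2 /[!inE] /familyP F1 /familyP F2 E; apply/ffunP => z.
have [->|zr] := eqVneq z r.
  have := F1 r; have := F2 r; rewrite /F eqxx orbT !inE => /eqP-> /eqP->//.
by move/ffunP/(_ z): E; rewrite !ffunE (negPf zr).
Qed.
End Counting.

(** * Numerical estimates *)

(* Bounds the number of functions outside [U 2 (n - 2)]: those separating the
   two parts, and those merging them but reaching every point of the second. *)
Definition loss n := n * (n.-1 ^ (n - 2) + n.-1 * (n - 2) ^ (n - 2)) + 2 * (n - 2) * n`!.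

Lemma leq_double_exp n : 0 < n -> 2 * n ^ n <= n.+1 ^ n.
Proof.
move=> n0; rewrite -[n.+1]addn1 expnDn (bigD1 ord0) //= (bigD1 (Ordinal (n0 : 1 < n.+1))) //=.
rewrite addnA -[leqLHS]addn0 leq_add // bin0 bin1 !exp1n !muln1 subn0 mul1n mul2n -addnn.
by rewrite leq_add2l -expnS subn1 prednK.
Qed.

(** Bernoulli's inequality for (1 - 1/a)^m, with denominators cleared. *)
Lemma leq_bernoulli a m : 0 < a -> a ^ m * (a - m) <= a.-1 ^ m * a.
Proof.
move=> a0; elim: m => [|m IH]; first by rewrite !expn0 subn0.
rewrite !expnS; apply: (@leq_trans (a.-1 * (a ^ m * (a - m)))).
  rewrite -mulnA [leqRHS]mulnCA [leqLHS]mulnCA leq_mul2l; apply/orP; right.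
  by case: a a0 {IH} => //= a _; rewrite subSS; nia.
by rewrite -mulnA leq_mul2l IH orbT.
Qed.

Lemma leq_fact_exp N : 5 <= N -> N`! <= 120 * N ^ (N - 5).
Proof.
move=> /subnK; move: (N - 5) => k <-; elim: k => [|k IH] //.
rewrite addSn factS expnS mulnCA leq_mul // (leq_trans IH) // leq_mul2l.
by case: k {IH} => // k; rewrite leq_exp2r // leqnSn.
Qed.

Lemma leq_binomial_head n : 2 <= n ->
  n ^ n.+1 + n.+1 * n ^ n + 'C(n.+1, 2) * n ^ n.-1 + 'C(n.+1, 3) * n ^ (n - 2)
    <= n.+1 ^ n.+1.
Proof.
case: n => [|[|n]] // _; rewrite -[X in _ <= X ^ _](addn1 n.+2) expnDn.
under eq_bigr do rewrite exp1n muln1.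
rewrite -(big_mkord xpredT (fun i => 'C(n.+3, i) * n.+2 ^ (n.+3 - i))).
do 4![rewrite big_ltn //].
rewrite bin0 bin1 mul1n subn0 !subSS !subn0 !addnA.
exact: leq_addr.
Qed.

(** The case n = 7 lies below the range of the general estimates and is evaluated; the products keep
    unary numerals small. *)
Lemma loss_7 : 7`! + 'C(7, 2) + loss 7 = 241 * 1000 + 143.
Proof.
have f7 : 7`! = 5 * 1008 by [].
have c7 : 'C(7, 2) = 21 by [].
have e6 : 7.-1 = 6 by [].
have e5 : 7 - 2 = 5 by [].
rewrite /loss f7 c7 e6 e5.
by rewrite !expnS !expn0; lia.
Qed.

(** Every summand is bounded by a polynomial times the common factor N^(N - 5), so that the later
    comparisons become polynomial in N = n - 1. *)
Lemma bound_large N : 10 <= N ->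
  2 * (N.+1`! + 'C(N.+1, 2) + loss N.+1) <=
  (N.+1 * (2 * N - 1) * 240 + N.+1 * N + N.+1 * (2 * N ^ 4 + N ^ 5)) * N ^ (N - 5).
Proof.
move=> N10; rewrite /loss /= factS bin2 /=.
have -> : N.+1 - 2 = N.-1 by lia.
have D := @leq_double_exp N.-1 ltac:(lia); rewrite prednK in D; last lia.
have F := leq_fact_exp (ltac:(lia) : 5 <= N).
have y1 : 0 < N ^ (N - 5) by rewrite expn_gt0; lia.
have E4 : N ^ N.-1 = N ^ 4 * N ^ (N - 5) by rewrite -expnD; congr expn; lia.
rewrite E4 in D *; set y := N ^ (N - 5) in y1 D F *.
rewrite [N ^ 5]expnS; set Q := N ^ 4 in D *.
set G := N.-1 ^ N.-1 in D *; set H := N`! in F *.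
have h1 : (N.+1 * N)./2 * 2 <= N.+1 * N by rewrite muln2; have := odd_double_half (N.+1 * N); lia.
move: (_ ./2) h1 => c h1.
clearbody y Q G H.
have a1 : N.+1 * (2 * N - 1) * H <= N.+1 * (2 * N - 1) * (120 * y) by rewrite leq_mul2l F orbT.
have a2 : N.+1 * N * (2 * G) <= N.+1 * N * (Q * y) by rewrite leq_mul2l D orbT.
have a3 : N.+1 * N <= N.+1 * N * y by rewrite leq_pmulr.
have a4 : N.+1 * H + 2 * N.-1 * (N.+1 * H) = N.+1 * (2 * N - 1) * H.
  have -> : 2 * N - 1 = 1 + 2 * N.-1 by lia.
  lia.
lia.
Qed.

Lemma prime_ge7 n : prime n -> 7 <= n -> n = 7 \/ 11 <= n.
Proof.
move=> pn n7; have [|n11] := leqP 11 n; [by right | left].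
by move: n pn n7 n11; do 11![case=> //].
Qed.

(** For n >= 11 and N = n - 1, the sum on the left is at most 3/4 of N^n, while n(n - 2) = N^2 - 1
    and Bernoulli's inequality leave at least 9/16 of N^(2n) on the right. *)
Lemma leq_bound_sqr n : prime n -> 7 <= n ->
  (n`! + 'C(n, 2) + loss n) ^ 2 <= (n * (n - 2)) ^ n.
Proof.
move=> pn n7; case: (prime_ge7 pn n7) => [->|n11].
  have -> : 7 * (7 - 2) = 35 by [].
  by rewrite loss_7 !expnS !expn0; lia.
case: n n11 {pn n7} => // N; rewrite ltnS => N10.
have := bound_large N10; set b := _ + loss _ => B.
have : 4 * b <= 3 * (N ^ N.+1).
  have -> : N ^ N.+1 = N ^ 6 * N ^ (N - 5) by rewrite -expnD; congr expn; lia.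
  have y1 : 0 < N ^ (N - 5) by rewrite expn_gt0; lia.
  have : 2 * (N.+1 * (2 * N - 1) * 240 + N.+1 * N + N.+1 * (2 * N ^ 4 + N ^ 5)) <= 3 * N ^ 6.
    have [k ->] : exists k, N = k + 10 by exists (N - 10); lia.
    have -> : 2 * (k + 10) - 1 = 2 * k + 19 by lia.
    rewrite !expnS expn0; lia.
  move: (N ^ (N - 5)) y1 B => y y1 B; move: (_ * 240 + _ + _) (N ^ 6) B => u v B; nia.
move=> {}B; have N1 : N.+1 * (N.+1 - 2) = (N ^ 2).-1 by nia.
have a0 : 0 < N ^ 2 by rewrite expn_gt0; lia.
have := @leq_bernoulli (N ^ 2) N.+1 a0; rewrite -N1.
have : 9 * N ^ 2 <= 16 * (N ^ 2 - N.+1) by nia.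
have eP : (N ^ N.+1) ^ 2 = (N ^ 2) ^ N.+1 by rewrite -!expnM mulnC.
have : 16 * b ^ 2 <= 9 * (N ^ 2) ^ N.+1.
  by rewrite -eP -[16]/(4 ^ 2) -[9]/(3 ^ 2) -!expnMn leq_sqr.
move: ((N ^ 2) ^ N.+1) => P; move: (N ^ 2 - N.+1) (b ^ 2) ((N.+1 * _) ^ _) => d b2 Q.
move: (N ^ 2) a0 => a a0 H1 H2 H3.
have h1 : a * (16 * b2) <= a * (9 * P) by rewrite leq_mul2l H1 orbT.
have h2 : P * (9 * a) <= P * (16 * d) by rewrite leq_mul2l H2 orbT.
rewrite -(leq_pmul2l a0); lia.
Qed.

(** For n >= 11 the first four terms of the binomial expansion of (N + 1)^(N + 1), with N = n - 1,
    already suffice. *)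
Lemma leq_bound_exp n : prime n -> 7 <= n ->
  2 * n.-1 ^ n + (n`! + 'C(n, 2) + loss n) <= n ^ n.
Proof.
move=> pn n7; case: (prime_ge7 pn n7) => [->|n11].
  have -> : 7.-1 = 6 by [].
  by rewrite loss_7 !expnS !expn0; lia.
case: n n11 {pn n7} => // N; rewrite ltnS => N10 /=.
have := bound_large N10; set b := _ + loss _ => B.
apply: leq_trans (leq_binomial_head (ltac:(lia) : 2 <= N)).
have c2 : 2 * 'C(N.+1, 2) = N.+1 * N.
  by rewrite -[2]/(2`!) mulnC bin_ffact ffactnS ffactn1.
have c3 : 6 * 'C(N.+1, 3) = N.+1 * N * N.-1.
  by rewrite -[6]/(3`!) mulnC bin_ffact !ffactnS ffactn0 muln1 mulnA.
have y1 : 0 < N ^ (N - 5) by rewrite expn_gt0; lia.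
have -> : N ^ N.+1 = N ^ 6 * N ^ (N - 5) by rewrite -expnD; congr expn; lia.
have -> : N ^ N = N ^ 5 * N ^ (N - 5) by rewrite -expnD; congr expn; lia.
have -> : N ^ N.-1 = N ^ 4 * N ^ (N - 5) by rewrite -expnD; congr expn; lia.
have -> : N ^ (N - 2) = N ^ 3 * N ^ (N - 5) by rewrite -expnD; congr expn; lia.
move: (N ^ (N - 5)) y1 B => y y1 B.
have H : 12 * N ^ 6 + 3 * (N.+1 * (2 * N - 1) * 240 + N.+1 * N + N.+1 * (2 * N ^ 4 + N ^ 5))
  <= 6 * (N ^ 6 + N.+1 * N ^ 5 + 'C(N.+1, 2) * N ^ 4 + 'C(N.+1, 3) * N ^ 3).
  have -> : 6 * (N ^ 6 + N.+1 * N ^ 5 + 'C(N.+1, 2) * N ^ 4 + 'C(N.+1, 3) * N ^ 3) =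
    6 * (N ^ 6 + N.+1 * N ^ 5) + 3 * (N.+1 * N) * N ^ 4 + N.+1 * N * N.-1 * N ^ 3.
    by rewrite -c3 -c2; lia.
  have [k ->] : exists k, N = k + 10 by exists (N - 10); lia.
  have -> : 2 * (k + 10) - 1 = 2 * k + 19 by lia.
  have -> : (k + 10).-1 = k + 9 by lia.
  rewrite !expnS expn0; lia.
have {}H := leq_mul H (leqnn y).
rewrite -(leq_pmul2l (isT : 0 < 6)).
rewrite !mulnA -!mulnDl -!mulnA in H *.
apply: leq_trans H; lia.
Qed.

(** The left side is at most e(2e + 1) + 4^e, which is below 5^e from e = 3 on. *)
Lemma leq_slack_bound n e : 7 <= n -> n.-1 <= 2 * e ->
  'C(n, 2) + 2 ^ n.-1 <= (n - 2) ^ e.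
Proof.
move=> n7 ne; have e3 : 3 <= e by lia.
apply: (@leq_trans (5 ^ e)); last by rewrite leq_exp2r //; lia.
have : 'C(n, 2) <= e * (2 * e + 1).
  rewrite bin2 -leq_double; have := odd_double_half (n * n.-1).
  have : n * n.-1 <= (2 * e + 1) * (2 * e) by apply: leq_mul; lia.
  lia.
have : 2 ^ n.-1 <= 4 ^ e by rewrite -[4]/(2 ^ 2) -expnM leq_exp2l.
move=> h1 h2; apply: (leq_trans (leq_add h2 h1)).
have [k ->] : exists k, e = k + 3 by exists (e - 3); lia.
elim: k => [|k IH] //; rewrite addSn !expnS.
have : 0 < 4 ^ (k + 3) by rewrite expn_gt0.
have k4 : k.+1 * 16 <= 4 ^ (k + 3).
  by elim: (k) => [|j jH] //; rewrite addSn expnS; lia.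
nia.
Qed.

(** * The set U *)

Lemma alpha_inj k l : injective (@alpha k l).
Proof.
rewrite /alpha => x y; case: (split_ordP x) => i ->; case: (split_ordP y) => j ->;
  rewrite ?split_lshift ?split_rshift ?unsplitK.
- by move=> /lshift_inj/ordS_inj->.
- by move=> /eqP; rewrite eq_lrshift.
- by move=> /eqP; rewrite eq_rlshift.
- by move=> /rshift_inj/ordS_inj->.
Qed.

(** A power of [alpha] is injective, hence merges no two points, so the exclusive alternative is an
    ordinary one. *)
Lemma in_U k l (g : {ffun 'I_(k + l) -> 'I_(k + l)}) :
  g \in U k l <-> is_alpha_power g \/ merges_and_misses g.
Proof.
have excl : is_alpha_power g -> ~ merges_and_misses g.
  move=> [m [_ gm]] [[i [j]]]; rewrite !gm => E _.
  have : lshift l i = rshift k j.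
    by elim: m E {gm} => //= m IH /alpha_inj/IH.
  by move/eqP; rewrite eq_lrshift.
rewrite inE; case: asboolP => [p|np]; case: asboolP => [q|nq] /=.
- by have := excl p q.
- by split=> // _; left.
- by split=> // _; right.
- by split=> // -[].
Qed.

(** * Conjugation into [U] and cardinality estimates *)

Section Transfer.
Variable T : finType.
Implicit Types (f g : {ffun T -> T}) (P Q : {set T}).

(** The second kind of element of [U], with an arbitrary set [P] in place of the first cycle. *)
Definition merging P : {set {ffun T -> T}} :=
  [set f : {ffun T -> T} | [exists i in P, exists j in ~: P, f i == f j] &&
           [exists m in ~: P, m \notin codom f]].

Lemma mergingP P f : reflect
  ((exists i j, [/\ i \in P, j \notin P & f i = f j]) /\
   exists2 m, m \notin P & m \notin codom f) (f \in merging P).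
Proof.
rewrite inE; apply: (iffP andP) => -[].
  move=> /exists_inP[i iP /exists_inP[j jP /eqP fij]] /exists_inP[m mP mf].
  rewrite !inE in jP mP.
  by split; [exists i, j | exists m].
case=> i [j [iP jP fij]] [m mP mf]; split.
  by apply/exists_inP; exists i => //; apply/exists_inP; exists j; rewrite ?inE ?fij.
by apply/exists_inP; exists m; rewrite ?inE.
Qed.

Section Conj.
Variables (k l : nat) (phi : 'I_(k + l) -> T) (psi : T -> 'I_(k + l)).
Hypotheses (phiK : cancel phi psi) (psiK : cancel psi phi).

Definition conj f : {ffun 'I_(k + l) -> 'I_(k + l)} := [ffun x => psi (f (phi x))].

Lemma conj_inj : injective conj.
Proof.
move=> f g /ffunP E; apply/ffunP => z; have := E (psi z); rewrite !ffunE psiK.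
exact: (can_inj psiK).
Qed.

Variable P : {set T}.
Hypothesis phiP : forall x, (phi x \in P) = (x < k).

Lemma conj_merging f : f \in merging P -> merges_and_misses (conj f).
Proof.
case/mergingP => -[i [j [iP jP fij]]] [m mP mf].
have inl z : z \in P -> exists y : 'I_k, z = phi (lshift l y).
  move=> zP; have := zP; rewrite -{1}(psiK z) phiP; case: (split_ordP (psi z)) => y E.
    by exists y; rewrite -E psiK.
  by [].
have inr z : z \notin P -> exists y : 'I_l, z = phi (rshift k y).
  move=> zP; have := zP; rewrite -{1}(psiK z) phiP; case: (split_ordP (psi z)) => y E.
    by [].
  by exists y; rewrite -E psiK.
have [i' iE] := inl _ iP; have [j' jE] := inr _ jP; have [m' mE] := inr _ mP.
split; first by exists i', j'; rewrite !ffunE -iE -jE fij.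
exists m' => z; rewrite ffunE => E; case/negP: mf.
by rewrite mE -E psiK codom_f.
Qed.

End Conj.

Lemma exists_bij_split P k l : #|P| = k -> #|T| = k + l ->
  exists2 phi : 'I_(k + l) -> T, bijective phi & forall x, (phi x \in P) = (x < k).
Proof.
move=> cP cT; pose s := enum P ++ enum (~: P).
have us : uniq s.
  rewrite cat_uniq !enum_uniq andbT /=; apply/hasPn => x.
  by rewrite !mem_enum inE.
have ss : size s = k + l.
  by rewrite size_cat -!cardE cP -cT -(cardsC P) cP.
have nthP x0 x : x < k + l -> (nth x0 s x \in P) = (x < k).
  move=> xkl; rewrite nth_cat -cardE cP; case: ltnP => xk.
    by rewrite -mem_enum mem_nth // -cardE cP.
  apply: negbTE; rewrite -in_setC -mem_enum mem_nth //.
  by rewrite -cardE -(ltn_add2l #|P|) cardsC cT cP subnKC.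
have [T0|/card_gt0P[x0 _]] := posnP #|T|.
  have kl0 (x : 'I_(k + l)) : False by case: x => x; rewrite -cT T0.
  exists (fun x => False_rect _ (kl0 x)); last by move=> x; case: (kl0 x).
  by apply: inj_card_bij; [move=> x; case: (kl0 x) | rewrite T0].
exists (fun x => nth x0 s x) => [|x]; last exact: nthP.
apply: inj_card_bij; last by rewrite card_ord cT.
by move=> x y /eqP; rewrite nth_uniq ?ss // => /eqP/val_inj.
Qed.

Lemma leq_card_merging P k l : #|P| = k -> #|T| = k + l -> #|merging P| <= #|U k l|.
Proof.
move=> cP cT; have [phi [psi phiK psiK] phiP] := exists_bij_split cP cT.
rewrite -(card_imset _ (conj_inj psiK)).
apply/subset_leq_card/subsetP => _ /imsetP[f fP ->].
by apply/in_U; right; apply: (conj_merging psiK phiP fP).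
Qed.

(** Numbering the two cycles by the iterates of [s] from [a] and from [b] turns [s] into [alpha],
    and conjugation maps the set into [U k l]. *)
Lemma leq_card_powers_merging (s : {perm T}) a b k l :
  porbit s a :|: porbit s b = setT -> b \notin porbit s a ->
  #|porbit s a| = k -> #|porbit s b| = l ->
  #|[set finfun (fun_of_perm u) | u in <[s]>%g] :|: merging (porbit s a)| <= #|U k l|.
Proof.
move=> ab ba ca cb.
pose phi (x : 'I_(k + l)) : T :=
  match split x with inl i => iter i s a | inr j => iter j s b end.
have itP x i : iter i s x \in porbit s x by rewrite -permX mem_porbit.
have ba' z : z \in porbit s b -> z \notin porbit s a.
  rewrite -!eq_porbit_mem => /eqP zb; apply: contra ba => /eqP za.
  by rewrite -eq_porbit_mem -zb za.
have phiP x : (phi x \in porbit s a) = (x < k).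
  rewrite /phi; case: (split_ordP x) => i _; first exact: itP.
  exact/negbTE/ba'/itP.
have iter_mod x i : iter (i %% #|porbit s x|) s x = iter i s x.
  rewrite [in RHS](divn_eq i #|porbit s x|) addnC iterD; congr (iter _ _ _).
  by elim: (_ %/ _) => //= q IH; rewrite mulSn addnC iterD iter_porbit.
have modk i : iter (i %% k) s a = iter i s a by rewrite -ca.
have modl i : iter (i %% l) s b = iter i s b by rewrite -cb.
have phi_alpha x : phi (alpha x) = s (phi x).
  rewrite /phi /alpha; case: (split_ordP x) => i _.
    by rewrite -[lshift _ _]/(unsplit (inl _)) unsplitK /= modk.
  by rewrite -[rshift _ _]/(unsplit (inr _)) unsplitK /= modl.
have surj z : exists x, phi x = z.
  have : z \in porbit s a :|: porbit s b by rewrite ab inE.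
  rewrite inE => /orP[]/porbitP[i ->]; rewrite permX -iter_mod.
    have ik : i %% #|porbit s a| < k by rewrite -ca ltn_mod lt0n card_porbit_neq0.
    by exists (lshift l (Ordinal ik)); rewrite /phi -[lshift _ _]/(unsplit (inl _)) unsplitK.
  have il : i %% #|porbit s b| < l by rewrite -cb ltn_mod lt0n card_porbit_neq0.
  by exists (rshift k (Ordinal il)); rewrite /phi -[rshift _ _]/(unsplit (inr _)) unsplitK.
have cT : #|T| = k + l.
  rewrite -cardsT -ab cardsU ca cb.
  have -> : porbit s a :&: porbit s b = set0.
    by apply/setP => z; rewrite !inE; apply/negP => /andP[za /ba']; rewrite za.
  by rewrite cards0 subn0.
have [psi phiK psiK] : bijective phi.
  have phi_onto : codom phi =i predT by move=> z; have [x <-] := surj z; rewrite codom_f.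
  have : injective phi by apply/injectiveP/card_uniqP; rewrite (eq_card phi_onto) size_codom card_ord cT.
  by move=> h; apply: inj_card_bij => //; rewrite cT card_ord.
rewrite -(card_imset _ (conj_inj psiK)).
apply/subset_leq_card/subsetP => _ /imsetP[f fP ->]; apply/in_U.
move: fP; rewrite in_setU => /orP[/imsetP[u us ->]|fP]; [left|right; exact: (conj_merging psiK phiP fP)].
(* Adding the order of [s] makes the exponent positive, as [is_alpha_power] demands. *)
have [m um] : exists m, u = (s ^+ m.+1)%g.
  have /cyclePmin[m _ ->] := us; exists (m + (#[s]%g).-1)%N.
  by rewrite -addnS prednK // expgD expg_order mulg1.
exists m.+1; split=> // z; rewrite !ffunE um permX.
apply: (can_inj phiK); rewrite psiK.
have {}um i : phi (iter i (@alpha k l) z) = iter i s (phi z) by elim: i => //= i <-.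
by rewrite um.
Qed.

(** A power of [s] is determined by its values on one root per cycle. The product of the cycle
    lengths c is at most the product of the 2^(c - 1), and there is at least one cycle. *)
Lemma order_perm_leq (s : {perm T}) : 0 < #|T| -> #[s]%g <= 2 ^ #|T|.-1.
Proof.
move=> T0.
pose root x := odflt x [pick y in porbit s x].
have rootP x : root x \in porbit s x.
  by rewrite /root; case: pickP => //= /(_ x); rewrite porbit_id.
have root_eq x y : y \in porbit s x -> root y = root x.
  move=> yx; rewrite /root; have -> : porbit s y = porbit s x by apply/eqP; rewrite eq_porbit_mem.
  by case: pickP => // /(_ y); rewrite yx.
pose F x : pred T := if root x == x then [pred y in porbit s x] else pred1 x.
pose h (u : {perm T}) : {ffun T -> T} := [ffun x => if root x == x then u x else x].
have hinj : {in <[s]>%g &, injective h}.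
  move=> u v us vs /ffunP E; apply/permP => x.
  have /porbitP[i ->] : x \in porbit s (root x) by rewrite porbit_sym rootP.
  have Er : u (root x) = v (root x).
    by have := E (root x); rewrite !ffunE (root_eq x _ (rootP x)) eqxx.
  have cu : commute u (s ^+ i)%g.
    by apply: (centsP (cycle_abelian s)) => //; rewrite mem_cycle.
  have cv : commute v (s ^+ i)%g.
    by apply: (centsP (cycle_abelian s)) => //; rewrite mem_cycle.
  by rewrite -!permM -cu -cv !permM Er.
rewrite orderE -(card_in_imset hinj).
apply: (@leq_trans #|[set f : {ffun T -> T} | f \in family F]|).
  apply/subset_leq_card/subsetP => _ /imsetP[u us ->]; rewrite inE; apply/familyP => x.
  rewrite /F ffunE; case: ifP => _; last by rewrite inE.
  by have /cycleP[i ->] := us; exact: mem_porbit.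
rewrite cardsE card_family_prod (bigID (fun x => root x == x)) /=.
rewrite [X in _ * X]big1 ?muln1 => [|x /negPf rx]; last by rewrite /F rx card1.
apply: (@leq_trans (\prod_(x | root x == x) 2 ^ #|porbit s x|.-1)).
  apply: leq_prod => x rx; rewrite /F rx.
  have : 0 < #|porbit s x| by rewrite lt0n card_porbit_neq0.
  by case: #|_| => // c _; rewrite /=; elim: c => // c IH; rewrite expnS; lia.
rewrite -expn_sum leq_exp2l //.
have [x0 x0r] : exists x0, root x0 == x0.
  by have /card_gt0P[x _] := T0; exists (root x); rewrite (root_eq x) ?rootP.
have : \sum_(x | root x == x) #|porbit s x| <= #|T|.
  have -> : #|T| = \sum_(x | root x == x) \sum_(y | root y == x) 1.
    rewrite -sum1_card (partition_big root (fun x => root x == x)) // => y _.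
    by rewrite (root_eq y) ?rootP.
  apply: leq_sum => x /eqP rx; rewrite sum1_card; apply/subset_leq_card/subsetP => y yx.
  by apply/eqP; rewrite -[RHS]rx; apply: root_eq.
have : \sum_(x | root x == x) #|porbit s x| =
    \sum_(x | root x == x) #|porbit s x|.-1 + \sum_(x | root x == x) 1.
  rewrite -big_split; apply: eq_bigr => x _ /=; rewrite addn1 prednK // lt0n.
  exact: card_porbit_neq0.
rewrite [X in _ + X](bigD1 x0) //=; lia.
Qed.

(** A function outside the set either shares no value between the pair and the rest, or merges one
    of the two points with some [j] outside the pair and reaches all points other than the pair;
    these cases give the two summands of [loss]. *)
Lemma leq_card_merging_pair (p0 p1 : T) : p0 != p1 ->
  #|T| ^ #|T| <= #|merging [set p0; p1]| + loss #|T|.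
Proof.
move=> p01.
pose D := [set f : {ffun T -> T} |
  [forall z in [set~ p0] :\ p1, (f z != f p0) && (f z != f p1)]].
pose S i i' j := [set f : {ffun T -> T} | (f i == f j) &&
      [forall m in [set~ i] :\ i', m \in codom f]].
have sub : ~: merging [set p0; p1] \subset
    D :|: (\bigcup_(j in [set~ p0] :\ p1) S p0 p1 j
       :|: \bigcup_(j in [set~ p0] :\ p1) S p1 p0 j).
  apply/subsetP => f; rewrite in_setC => fN; rewrite in_setU.
  have [//|fD] := boolP (f \in D); rewrite orFb.
  have onto m : m != p0 -> m != p1 -> m \in codom f.
    move=> m0 m1; apply: contraNT fN => mf; apply/mergingP; split; last first.
      by exists m; rewrite // !inE negb_or m0.
    move: fD; rewrite inE negb_forall_in => /exists_inP[z zP].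
    have zn : z \notin [set p0; p1] by move: zP; rewrite !inE negb_or andbC.
    rewrite negb_and !negbK => /orP[]/eqP E.
      by exists p0, z; split; [rewrite !inE eqxx | | rewrite E].
    by exists p1, z; split; [rewrite !inE eqxx orbT | | rewrite E].
  move: fD; rewrite inE negb_forall_in => /exists_inP[z zP].
  rewrite negb_and !negbK inE => /orP[]/eqP E; apply/orP; [left|right];
    apply/bigcupP; exists z => //; rewrite inE E eqxx; apply/forall_inP => m;
    by rewrite !inE => /andP[? ?]; apply: onto.
have cQ : #|[set~ p0] :\ p1| = #|T| - 2.
  by have := cardsD1 p1 [set~ p0]; rewrite !inE eq_sym p01 cardsC1; lia.
have cS i i' : i != i' -> [set~ p0] :\ p1 \subset [set~ i] ->
    #|\bigcup_(j in [set~ p0] :\ p1) S i i' j| <= (#|T| - 2) * #|T|`!.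
  move=> ii' sb; apply: (leq_trans (leq_card_bigcup _ _)).
  rewrite -cQ -sum_nat_const; apply: leq_sum => j jP.
  by apply: card_merging_onto => //; have := subsetP sb j jP; rewrite !inE.
rewrite -card_ffun -(cardsC (merging [set p0; p1])) leq_add2l.
apply: (leq_trans (subset_leq_card sub)).
apply: (leq_trans (leq_card_setU _ _).1); apply: leq_add.
  exact: card_disjoint_pair.
apply: (leq_trans (leq_card_setU _ _).1); rewrite -mulnA mul2n -addnn leq_add // cS //.
- by apply/subsetP => z; rewrite !inE => /andP[].
- by rewrite eq_sym.
- by apply/subsetP => z; rewrite !inE => /andP[].
Qed.

End Transfer.

Lemma leq_card_U2 n : 2 <= n -> n ^ n <= #|U 2 (n - 2)| + loss n.
Proof.
move=> n2; pose p0 : 'I_n := Ordinal (ltnW n2); pose p1 : 'I_n := Ordinal n2.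
have := @leq_card_merging_pair _ p0 p1 isT; rewrite card_ord => /leq_trans; apply.
rewrite leq_add2r; apply: leq_card_merging; first by rewrite cards2.
by rewrite card_ord subnKC.
Qed.

(** * Redundant transformations *)

Section Redundant.
Variable n : nat.
Implicit Types (x a b : 'I_n).

Definition bump_at x a b : {ffun 'I_n -> 'I_n} := [ffun z => if z == x then b else a].

(** One of the two orders for every pair of distinct values: the n choose 2 maps to be discarded. *)
Definition descents x := [set bump_at x p.1 p.2 | p in [set p : 'I_n * 'I_n | p.2 < p.1]].

Lemma bump_at_inj x : 1 < n -> injective (fun p => bump_at x p.1 p.2).
Proof.
move=> n1 [a b] [a' b'] /ffunP /= E.
have [z zx] : exists z, z != x.
  have /card_gt0P[z] : 0 < #|[set~ x]| by rewrite cardsC1 card_ord; lia.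
  by rewrite !inE; exists z.
have := E x; have := E z; rewrite !ffunE eqxx (negPf zx) => -> -> //.
Qed.

Lemma card_descents x : 1 < n -> #|descents x| = 'C(n, 2).
Proof.
move=> n1; rewrite card_imset; last exact: bump_at_inj.
rewrite -bin2_sum big_mkord.
have -> : #|[set p : 'I_n * 'I_n | p.2 < p.1]| =
    #|[set p : 'I_n * 'I_n | (p.1 \in [set: 'I_n]) && (p.2 < p.1)]|.
  by apply: eq_card => p; rewrite !inE.
rewrite (card_dep_pairs [set: 'I_n] (fun i j : 'I_n => j < i)).
apply: eq_big => [i|i _]; first by rewrite inE.
have winj : injective (widen_ord (ltnW (ltn_ord i))).
  by move=> j j' /(congr1 val) /= /val_inj.
rewrite -[RHS]card_ord -(card_image winj).
apply: eq_card => j; apply/idP/imageP => [ji|[j' _ ->]]; last exact: (ltn_ord j').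
by exists (Ordinal ji) => //; apply: val_inj.
Qed.

(** Both sides keep a point other than [x], and these two points go to [a]; three points outside [P]
    cannot all lie in an image of at most two. *)
Lemma bump_at_merging (P : {set 'I_n}) x a b : 2 <= #|P| -> 3 <= #|~: P| -> bump_at x a b \in merging P.
Proof.
move=> P2 P3; apply/mergingP; split.
  have /card_gt0P[i] : 0 < #|P :\ x| by move: P2; rewrite (cardsD1 x P); case: (x \in P); case: #|_|.
  have /card_gt0P[j] : 0 < #|(~: P) :\ x|.
    by move: P3; rewrite (cardsD1 x (~: P)); case: (x \in ~: P); case: #|_|.
  rewrite !inE => /andP[jx jP] /andP[ix iP]; exists i, j; split=> //.
  by rewrite !ffunE (negPf jx) (negPf ix).
have /card_gt0P[m] : 0 < #|~: P :\: [set a; b]|.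
  rewrite -(ltn_add2l #|~: P :&: [set a; b]|) cardsID addn0.
  apply: (leq_ltn_trans (subset_leq_card (subsetIr _ _))).
  by rewrite cards2; case: (a != b) => //; apply: ltnW.
rewrite !inE negb_or => /andP[/andP[ma mb] mP]; exists m => //.
by apply/negP => /codomP[z]; rewrite ffunE; case: ifP => _ E; rewrite E eqxx in ma mb.
Qed.

Variables (q0 : 'I_n) (F : pred 'I_n).

(** The orbit of [q0] visits [h b] first and, unless [h b] is the final state [q0], then [h a];
    acceptance is therefore symmetric in [a] and [b]. *)
Lemma accepts_bump_final a b (h : {ffun 'I_n -> 'I_n}) : F q0 ->
  accepts q0 F (h \o bump_at q0 a b) <-> F (h a) || F (h b).
Proof.
move=> Fq; split=> [[m]|].
  by rewrite iterS /= ffunE; case: ifP => _ ->; rewrite ?orbT.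
have [hb|hb] := eqVneq (h b) q0.
  by exists 0; rewrite /= ffunE eqxx hb.
case/orP => [Fa|Fb]; last by exists 0; rewrite /= ffunE eqxx.
by exists 1; rewrite /= /bump_at !ffunE eqxx (negPf hb).
Qed.

(** The orbit goes to [h a] and stays there, unless [h a] is [x], which is final anyway; the value
    [b] never decides. *)
Lemma accepts_bump_nonfinal x a b (h : {ffun 'I_n -> 'I_n}) : ~~ F q0 -> F x ->
  accepts q0 F (h \o bump_at x a b) <-> F (h a).
Proof.
move=> Fq Fx.
have q0x : q0 != x by apply: contraNneq Fq => ->.
split=> [[m]|Fa]; last by exists 0; rewrite /= ffunE (negPf q0x).
have [ha _|hx] := eqVneq (h a) x; first by rewrite ha.
have -> : iter m.+1 (h \o bump_at x a b) q0 = h a; last by [].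
elim: m => [|m IH]; first by rewrite /= ffunE (negPf q0x).
by rewrite iterS IH /= ffunE (negPf hx).
Qed.

Lemma descents_redundant (W : {set {ffun 'I_n -> 'I_n}}) : 1 < n ->
  (forall x a b, bump_at x a b \in W) ->
  exists x (kappa : {ffun 'I_n -> 'I_n} -> {ffun 'I_n -> 'I_n}), {in descents x, forall f, kappa f \in W :\: descents x /\
    forall h : {ffun 'I_n -> 'I_n}, accepts q0 F (h \o f) <-> accepts q0 F (h \o kappa f)}.
Proof.
move=> n1 bW.
have notD x a b : a <= b -> bump_at x a b \in W :\: descents x.
  move=> ab; rewrite inE bW andbT; apply/imsetP => -[[a' b']]; rewrite inE /= => ba.
  by move=> /(@bump_at_inj x n1 (a, b) (a', b')) [ea eb]; rewrite ea eb leqNgt ba in ab.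
have other x : exists z, z != x.
  have /card_gt0P[z] : 0 < #|[set~ x]| by rewrite cardsC1 card_ord; lia.
  by rewrite !inE; exists z.
have [Fq|Fq] := boolP (F q0).
  have [z zq] := other q0.
  (* For [f] in [descents q0] this exchanges the two values. *)
  exists q0, (fun f : {ffun 'I_n -> 'I_n} => bump_at q0 (f q0) (f z)) => _ /imsetP[[a b] ba ->]; rewrite inE /= in ba *.
  rewrite !ffunE eqxx (negPf zq); split; first by apply: notD; apply: ltnW.
  by move=> h; rewrite !accepts_bump_final // orbC.
have [[x Fx]|no] := pselect (exists x, F x).
  have [z zx] := other x.
  (* For [f] in [descents x] this is the constant map with the value taken off [x]. *)
  exists x, (fun f : {ffun 'I_n -> 'I_n} => bump_at x (f z) (f z)) => _ /imsetP[[a b] ba ->]; rewrite inE /= in ba *.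
  rewrite !ffunE (negPf zx); split; first exact: notD.
  by move=> h; rewrite !accepts_bump_nonfinal.
(* Without final states nothing is accepted, so any element outside [descents q0] can be the
   partner. *)
exists q0, (fun=> bump_at q0 q0 q0) => f fD; split; first exact: notD.
by move=> h; split=> -[m Fm]; case: no; eexists; exact: Fm.
Qed.

End Redundant.

(** * Upper bound *)

Lemma act_in (T Sigma : finType) (d : T -> Sigma -> T) (W : {set {ffun T -> T}}) :
  [ffun z => z] \in W ->
  (forall (f : {ffun T -> T}) x, f \in W -> [ffun z => d (f z) x] \in W) ->
  forall u, act d u \in W.
Proof.
move=> W1 Wd; elim/last_ind => [|u x IH]; first by rewrite [act _ _](_ : _ = [ffun z => z]).
by rewrite act_rcons Wd.
Qed.

Lemma not_injective_misses (T : finType) (f : T -> T) :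
  ~ injective f -> exists m, forall z, f z != m.
Proof.
move=> ninj; apply: contrapT => no; apply: ninj; apply/injectiveP/card_uniqP.
rewrite size_codom; apply: eq_card => z; rewrite inE; apply: contrapT => nz.
by apply: no; exists z => u; apply/eqP => zE; apply: nz; rewrite -zE codom_f.
Qed.

Section Letters.
Variables (n : nat) (n_prime : prime n) (n_ge7 : 7 <= n).
Variables (mu : nat) (muP : forall k l, 2 <= k -> 3 <= l -> k + l = n -> #|U k l| <= mu).
Implicit Types (f g : {ffun 'I_n -> 'I_n}) (a b m x y z : 'I_n).

Let bound := n`! + 'C(n, 2) + loss n.

Lemma leq_mu : n ^ n <= mu + loss n.
Proof.
have n2 : 2 <= n by lia.
apply: (leq_trans (leq_card_U2 n2)); rewrite leq_add2r muP //; lia.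
Qed.

(** As [mu] is at least n^n - [loss n], a set of n! + c functions is small enough once c leaves
    [bound] of all n^n functions out. *)
Lemma leq_mu_subC2 c : c + bound <= n ^ n -> n`! + c <= mu - 'C(n, 2).
Proof. by rewrite /bound; have := leq_mu; lia. Qed.

Lemma bound_exp : 2 * n.-1 ^ n + bound <= n ^ n.
Proof. exact: leq_bound_exp. Qed.

Lemma bound_leq c : (n * (n - 2)) ^ n <= c ^ 2 -> bound <= c.
Proof.
by move=> h; rewrite -leq_sqr; apply: leq_trans h; apply: leq_bound_sqr.
Qed.

Lemma bound_leq_predn : bound <= n.-1 ^ n.
Proof.
apply: bound_leq; have -> : (n.-1 ^ n) ^ 2 = (n.-1 ^ 2) ^ n by rewrite -!expnM mulnC.
by rewrite leq_exp2r; [nia | lia].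
Qed.

Lemma card_injective : #|[set f : {ffun 'I_n -> 'I_n} | injectiveb f]| = n`!.
Proof. by rewrite card_inj_ffuns card_ord ffactnn. Qed.

Lemma card_misses_ord (q : 'I_n) : #|[set f : {ffun 'I_n -> 'I_n} | q \notin codom f]| = n.-1 ^ n.
Proof. by rewrite card_misses card_ord. Qed.

(** * One permutation letter and one non-injective letter *)

Section Mixed.
Variables (s : {perm 'I_n}) (beta : 'I_n -> 'I_n) (a b m : 'I_n).
Hypotheses (ab : a != b) (beta_ab : beta a = beta b) (beta_m : forall z, beta z != m).

Definition perm_powers : {set {ffun 'I_n -> 'I_n}} := [set finfun (fun_of_perm u) | u in <[s]>%g].

(** Together with the powers of [s], this set is closed under applying either letter afterwards, so
    it contains every non-injective transformation of a word. *)
Definition orbit_merging : {set {ffun 'I_n -> 'I_n}} :=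
  [set f : {ffun 'I_n -> 'I_n} | [exists u in <[s]>%g, f (u a) == f (u b)] &&
    [exists x in porbit s m, x \notin codom f]].

Lemma id_perm_powers : [ffun z => z] \in perm_powers.
Proof. by apply/imsetP; exists 1%g; rewrite ?group1 //; apply/ffunP => z; rewrite !ffunE perm1. Qed.

Lemma mixed_perm f : f \in perm_powers :|: orbit_merging -> [ffun z => s (f z)] \in perm_powers :|: orbit_merging.
Proof.
rewrite !in_setU => /orP[/imsetP[u us ->]|].
  apply/orP; left; apply/imsetP; exists (u * s)%g; first by rewrite groupM ?cycle_id.
  by apply/ffunP => z; rewrite !ffunE permM.
rewrite inE => /andP[/exists_inP[u us /eqP E] /exists_inP[x xm xf]].
apply/orP; right; rewrite inE; apply/andP; split; apply/exists_inP.
  by exists u; rewrite // !ffunE E.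
exists (s x).
  by have /porbitP[i ->] := xm; rewrite -permM -expgSr mem_porbit.
apply: contra xf => /codomP[z]; rewrite ffunE => /perm_inj->; exact: codom_f.
Qed.

Lemma mixed_beta f : f \in perm_powers :|: orbit_merging -> [ffun z => beta (f z)] \in perm_powers :|: orbit_merging.
Proof.
have bm g : exists2 x, x \in porbit s m & x \notin codom [ffun z => beta (g z)].
  exists m; first exact: porbit_id.
  by apply/negP => /codomP[z]; rewrite ffunE => /eqP; rewrite eq_sym (negPf (beta_m _)).
rewrite !in_setU => /orP[/imsetP[u us ->]|fm]; apply/orP; right; rewrite inE; apply/andP; split;
  apply/exists_inP; try exact: bm.
  exists (u^-1)%g; first by rewrite groupV.
  by rewrite !ffunE !permKV beta_ab.
move: fm; rewrite inE => /andP[/exists_inP[u us /eqP E] _].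
by exists u; rewrite // !ffunE E.
Qed.

Lemma perm_powers_injective : perm_powers \subset [set f : {ffun 'I_n -> 'I_n} | injectiveb f].
Proof.
apply/subsetP => _ /imsetP[u us ->]; rewrite inE; apply/injectiveP => x y.
by rewrite !ffunE => /perm_inj.
Qed.

Lemma card_perm_powers : #|perm_powers| <= 2 ^ n.-1.
Proof.
apply: (leq_trans (leq_imset_card _ _)).
by have := @order_perm_leq _ s; rewrite card_ord orderE; apply; lia.
Qed.

(** With b = t(a) for a power [t] of [s], every map in [orbit_merging] identifies some z in the
    cycle of [a] with t(z). Proper colourings of the graph with edges z, t(z) are thus excluded, and
    there are enough of them. *)
Lemma card_mixed_same : b \in porbit s a -> #|perm_powers :|: orbit_merging| <= mu - 'C(n, 2).
Proof.
case/porbitP => d bE; pose t := (s ^+ d)%g; pose C := enum (porbit s a).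
have tC x : x \in C -> t x \in C.
  rewrite !mem_enum => /porbitP[i ->]; rewrite /t -permM -expgD; exact: mem_porbit.
have tx x : x \in C -> t x != x.
  rewrite mem_enum => /porbitP[i ->]; apply/negP => /eqP.
  rewrite /t -permM -expgD addnC expgD permM => /perm_inj E.
  by move: ab; rewrite bE E eqxx.
have := @card_avoid_cycles _ t C _ (enum_uniq _) tx; rewrite card_ord => /(_ ltac:(lia)) /=.
set e := count _ _; set S := [set f | _] => H.
have en : e <= n.
  apply: (leq_trans (count_size _ _)); rewrite -cardE -[X in _ <= X]card_ord; exact: max_card.
(* Since n - 2 <= n, the exponent [e] may be raised to n. *)
have {}H : (n * (n - 2)) ^ n <= #|S| ^ 2.
  have n0 : 0 < n ^ n by rewrite expn_gt0; lia.
  rewrite -(leq_pmul2l n0) expnMn.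
  have -> : n ^ n * (n ^ n * (n - 2) ^ n) = (n ^ n) ^ 2 * (n - 2) ^ e * (n - 2) ^ (n - e).
    by rewrite -[RHS]mulnA -expnD subnKC // expnS expn1 mulnA.
  apply: (leq_trans (leq_mul H (leqnn _))).
  have -> : n ^ n = n ^ e * n ^ (n - e) by rewrite -expnD subnKC.
  rewrite -mulnA [_ * (_ - _) ^ _]mulnC -!mulnA leq_mul2l; apply/orP; right.
  rewrite leq_mul2r; apply/orP; right.
  have [->|ne] := posnP (n - e); first by rewrite !expn0.
  by rewrite leq_exp2r //; lia.
have sub : perm_powers :|: orbit_merging \subset [set f : {ffun 'I_n -> 'I_n} | injectiveb f] :|: ~: S.
  apply/subUsetP; split; first exact: subset_trans perm_powers_injective (subsetUl _ _).
  apply/subsetP => f; rewrite in_setU in_setC inE => /andP[/exists_inP[u us /eqP E] _].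
  apply/orP; right; apply/negP; rewrite inE => /allP fS.
  have /cycleP[i uE] := us.
  have uC : u a \in C by rewrite mem_enum uE mem_porbit.
  have := fS _ uC; rewrite tC //= {1}E bE /t uE -!permM -!expgD addnC eqxx //.
apply: (leq_trans (subset_leq_card sub)); apply: (leq_trans (leq_card_setU _ _).1).
rewrite card_injective; apply: leq_mu_subC2.
have := cardsC S; rewrite card_ffun card_ord => <-.
by rewrite addnC leq_add2r; apply: bound_leq.
Qed.

Hypotheses (bPa : b \notin porbit s a) (mPa : m \notin porbit s a).

(** [P] contains the cycle of [a] and avoids those of [b] and [m], so merging along the orbit of the
    pair becomes merging across [P]. *)
Let P := if m \in porbit s b then ~: porbit s b else porbit s a.

Lemma porbit_disjoint x : x \in porbit s a -> x \notin porbit s b.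
Proof.
rewrite -eq_porbit_mem => /eqP xa; apply: contra bPa.
by rewrite -!eq_porbit_mem xa => /eqP->.
Qed.

Lemma sub_porbit_a x : x \in porbit s a -> x \in P.
Proof. by rewrite /P; case: ifP => // _ /porbit_disjoint; rewrite inE. Qed.

Lemma sub_porbit_b x : x \in porbit s b -> x \notin P.
Proof.
rewrite /P; case: ifP => [_ xb|_ xb]; first by rewrite inE xb.
by apply/negP => /porbit_disjoint; rewrite xb.
Qed.

Lemma sub_porbit_m x : x \in porbit s m -> x \notin P.
Proof.
rewrite -eq_porbit_mem => /eqP xm; rewrite /P; case: ifP => [mb|_].
  by rewrite inE negbK -eq_porbit_mem xm eq_porbit_mem.
by rewrite -eq_porbit_mem xm eq_porbit_mem.
Qed.

Lemma orbit_mergingP f : f \in orbit_merging ->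
  (exists x y, [/\ x \in porbit s a, y \in porbit s b & f x = f y]) /\
  exists2 x, x \in porbit s m & x \notin codom f.
Proof.
rewrite inE => /andP[/exists_inP[u us /eqP E] /exists_inP]; split=> //.
by have /cycleP[i uE] := us; exists (u a), (u b); rewrite uE !mem_porbit -uE E.
Qed.

Lemma orbit_merging_sub : orbit_merging \subset merging P.
Proof.
apply/subsetP => f /orbit_mergingP[[x [y [xa yb E]]] [z zm zf]]; apply/mergingP; split.
  by exists x, y; split; [apply: sub_porbit_a | apply: sub_porbit_b |].
by exists z => //; apply: sub_porbit_m.
Qed.

Lemma card_mixed_small : #|~: P| <= 2 -> #|perm_powers :|: orbit_merging| <= mu - 'C(n, 2).
Proof.
move=> l2.
have sub : perm_powers :|: orbit_merging \subset [set f : {ffun 'I_n -> 'I_n} | injectiveb f] :|: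
    \bigcup_(q in ~: P) [set f : {ffun 'I_n -> 'I_n} | q \notin codom f].
  apply: setUSS; first exact: perm_powers_injective.
  apply/subsetP => f /(subsetP orbit_merging_sub)/mergingP[_ [q qP qf]].
  by apply/bigcupP; exists q; rewrite inE.
apply: (leq_trans (subset_leq_card sub)); apply: (leq_trans (leq_card_setU _ _).1).
rewrite card_injective; apply: leq_trans (leq_mu_subC2 bound_exp); rewrite leq_add2l.
apply: (leq_trans (leq_card_bigcup _ _)).
under eq_bigr do rewrite card_misses_ord.
by rewrite sum_nat_const leq_mul2r l2 orbT.
Qed.

(** Here [P] is the single point [a], so the maps giving [a] a value of its own are excluded; there
    are at least n(n - 1)^(n - 1) of them. *)
Lemma card_mixed_single : #|P| <= 1 -> #|perm_powers :|: orbit_merging| <= mu - 'C(n, 2).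
Proof.
move=> k1; have PE x : x \in P -> x = a.
  have aP : a \in P by rewrite sub_porbit_a ?porbit_id.
  by move=> xP; apply: (card_le1_eqP k1).
have aE : a \notin enum [set~ a] by rewrite mem_enum !inE eqxx.
have := card_avoid_star (enum_uniq [set~ a]) aE; rewrite -cardE cardsC1 card_ord.
set S := [set f | _] => H.
have {}H : bound <= #|S|.
  apply: (leq_trans bound_leq_predn).
  have n0 : 0 < n ^ n.-1 by rewrite expn_gt0; lia.
  rewrite -(leq_pmul2l n0); apply: leq_trans H.
  have -> : n.-1 ^ n = n.-1 * n.-1 ^ n.-1 by rewrite -expnS prednK //; lia.
  have -> : n ^ n = n * n ^ n.-1 by rewrite -expnS prednK //; lia.
  rewrite mulnCA -[leqRHS]mulnA leq_mul2r leq_pred orbT //.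
have sub : perm_powers :|: orbit_merging \subset [set f : {ffun 'I_n -> 'I_n} | injectiveb f] :|: ~: S.
  apply: setUSS; first exact: perm_powers_injective.
  apply/subsetP => f /(subsetP orbit_merging_sub)/mergingP[[x [y [/PE-> yP E]]] _].
  rewrite inE; apply/negP; rewrite inE => /allP fS.
  have /fS : y \in enum [set~ a]; last by rewrite E eqxx.
  by rewrite mem_enum !inE; apply: contraNneq yP => ->; rewrite sub_porbit_a ?porbit_id.
apply: (leq_trans (subset_leq_card sub)); apply: (leq_trans (leq_card_setU _ _).1).
rewrite card_injective; apply: leq_mu_subC2.
by have := cardsC S; rewrite card_ffun card_ord => <-; rewrite addnC leq_add2r.
Qed.

(* A third cycle leaves room for functions that are constant on [X] and merge
   across [P] only at a point [r] outside both orbits. *)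
Lemma card_mixed_slack : 2 <= #|P| -> 3 <= #|~: P| ->
  porbit s a :|: porbit s b != setT -> #|perm_powers :|: orbit_merging| <= mu - 'C(n, 2).
Proof.
move=> k2 l3 /eqP abT.
have [r ra rb] : exists2 r, r \notin porbit s a & r \notin porbit s b.
  have /set0Pn[r] : ~: (porbit s a :|: porbit s b) != set0.
    by apply/eqP => E; apply: abT; rewrite -[LHS]setCK E setC0.
  by rewrite !inE negb_or => /andP[? ?]; exists r.
have cab : #|porbit s a| + #|porbit s b| < n.
  have dis : porbit s a :&: porbit s b = set0.
    by apply/setP => z; rewrite !inE; apply/negP => /andP[/porbit_disjoint/negPf->].
  rewrite -cardsUI dis cards0 addn0 -[X in _ < X]card_ord -cardsT.
  by rewrite proper_card // properE subsetT; apply/subsetPn; exists r; rewrite ?inE // negb_or ra.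
(* The smaller cycle has at most (n - 1)/2 points, because [r] lies in neither; [y] below is chosen
   on the other side of [P] from [r]. *)
pose X := if #|porbit s a| <= #|porbit s b| then porbit s a else porbit s b.
pose y := if m \in porbit s b then b else a.
have half p q : p + q < n -> p <= q -> 2 * p <= n.-1 by lia.
have X2 : 2 * #|X| <= n.-1.
  rewrite /X; case: (leqP #|porbit s a| #|porbit s b|) => [h|/ltnW h].
  exact: half cab h.
  by rewrite addnC in cab; exact: half cab h.
have rX : r \notin X by rewrite /X; case: ifP.
have yr : y != r.
  by rewrite /y; case: ifP => _; apply/eqP => E; move: ra rb; rewrite -E porbit_id.
have am : a != m by apply/eqP => E; move: mPa; rewrite -E porbit_id.
have := card_slack rX yr am; set SL := [set f | _]; rewrite card_ord => cSL.
have {}cSL : 'C(n, 2) + 2 ^ n.-1 <= #|SL| by apply: leq_trans cSL; apply: leq_slack_bound; move: X2; move: #|_|; lia.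
have mP : m \notin P by rewrite sub_porbit_m ?porbit_id.
have SLm : SL \subset merging P.
  apply/subsetP => f; rewrite inE => /andP[/and3P[_ /eqP ry _] mf]; apply/mergingP; split; last by exists m.
  move: ry; rewrite /y /P; case: ifP => mb ry.
    by exists r, b; rewrite !inE rb porbit_id.
  by exists a, r; rewrite porbit_id.
(* A map in [SL] is constantly [a] on one of the two cycles and never [a] on the other, so it cannot
   merge them. *)
have sub : perm_powers :|: orbit_merging \subset perm_powers :|: (merging P :\: SL).
  apply: setUS; apply/subsetP => f fm; rewrite in_setD (subsetP orbit_merging_sub) // andbT.
  have [[u [v [ua vb E]]] _] := orbit_mergingP fm.
  rewrite inE; apply/negP => /andP[/and3P[/forall_inP fX _ /forallP fN] _].
  move: fX fN; rewrite /X; case: ifP => _ fX fN.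
    have := fN v; rewrite -E (eqP (fX u ua)) eqxx implybF negb_and !negbK.
    case/orP => [/porbit_disjoint|/eqP vr]; first by rewrite vb.
    by move: rb; rewrite -vr vb.
  have := fN u; rewrite E (eqP (fX v vb)) eqxx implybF negb_and !negbK.
  case/orP => [ub|/eqP ur]; first by have := porbit_disjoint ua; rewrite ub.
  by move: ra; rewrite -ur ua.
apply: (leq_trans (subset_leq_card sub)); apply: (leq_trans (leq_card_setU _ _).1).
have le_mu : #|merging P| <= mu.
  have kl : #|P| + #|~: P| = n by rewrite cardsC card_ord.
  apply: leq_trans (muP k2 l3 kl); apply: leq_card_merging => //.
  by rewrite card_ord.
have := card_perm_powers; have := cardsID SL (merging P); rewrite (setIidPr SLm).
move: cSL le_mu; move: #|SL| #|merging P| #|perm_powers| #|_ :\: _|; lia.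
Qed.

(** Only the case of exactly two cycles needs the second alternative: there the estimate by [mu] has
    no slack, and the redundant maps in [W] remain to be subtracted. *)
Lemma mixed_diff : #|perm_powers :|: orbit_merging| <= mu - 'C(n, 2) \/
  exists W : {set {ffun 'I_n -> 'I_n}},
    [/\ perm_powers :|: orbit_merging \subset W, #|W| <= mu & forall x c e, bump_at x c e \in W].
Proof.
have [l2|l3] := leqP #|~: P| 2; first by left; apply: card_mixed_small.
have [k1|k2] := leqP #|P| 1; first by left; apply: card_mixed_single.
have [abT|abT] := eqVneq (porbit s a :|: porbit s b) setT; last first.
  by left; apply: card_mixed_slack.
right; have PE : P = porbit s a.
  apply/setP => x; apply/idP/idP => [xP|/sub_porbit_a//].
  have : x \in porbit s a :|: porbit s b by rewrite abT inE.
  by rewrite inE => /orP[//|/sub_porbit_b]; rewrite xP.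
have PC : ~: P = porbit s b.
  apply/setP => x; rewrite inE; apply/idP/idP => [|/sub_porbit_b//].
  have : x \in porbit s a :|: porbit s b by rewrite abT inE.
  by rewrite PE inE => /orP[->|].
exists (perm_powers :|: merging P); split.
- exact/setUS/orbit_merging_sub.
- have kl : #|P| + #|~: P| = n by rewrite cardsC card_ord.
  apply: leq_trans (muP k2 l3 kl); rewrite PE.
  by apply: (leq_card_powers_merging abT bPa) => //; rewrite -PC PE.
- by move=> x c e; rewrite in_setU bump_at_merging ?orbT.
Qed.

End Mixed.

Lemma orbit_merging_sym s a b m : orbit_merging s a b m = orbit_merging s b a m.
Proof.
apply/setP => f; rewrite !inE; congr (_ && _).
by apply: eq_existsb => u; rewrite [f _ == _]eq_sym.
Qed.

(** If [a] and [b] lie in different cycles, [m] is outside one of them, and [a] and [b] can be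
    exchanged. *)
Lemma mixed_bound (s : {perm 'I_n}) a b m : a != b ->
  #|perm_powers s :|: orbit_merging s a b m| <= mu - 'C(n, 2) \/
  exists W : {set {ffun 'I_n -> 'I_n}},
    [/\ perm_powers s :|: orbit_merging s a b m \subset W, #|W| <= mu & forall x c e, bump_at x c e \in W].
Proof.
move=> ab; have [ba|ba] := boolP (b \in porbit s a).
  by left; apply: card_mixed_same.
have [ma|] := boolP (m \in porbit s a); last exact: mixed_diff.
have mb : m \notin porbit s b.
  apply: contra ba; rewrite -!eq_porbit_mem in ma *; rewrite -(eqP ma) => /eqP->.
  by [].
rewrite orbit_merging_sym; apply: mixed_diff => //; first by rewrite eq_sym.
by rewrite porbit_sym.
Qed.

(** * Upper bound for two letters *)

Section Root.
Variables (Sigma : finType) (L : language Sigma) (hL : regular L).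
Variables (d : 'I_n -> Sigma -> 'I_n) (q0 : 'I_n) (F : pred 'I_n).
Hypothesis LF : forall w, L w <-> F (foldl d q0 w).

Lemma sc_root_mixed (s : {perm 'I_n}) (beta : 'I_n -> 'I_n) :
  ~ injective beta -> (forall x : Sigma, (forall z, d z x = s z) \/ (forall z, d z x = beta z)) ->
  sc (root_lang L) (regular_root hL) <= mu - 'C(n, 2).
Proof.
move=> ninj dx.
have [a [b [ab E]]] : exists a b, a != b /\ beta a = beta b.
  apply: contrapT => no; apply: ninj => a b E; apply/eqP; apply: contrapT => ab.
  by apply: no; exists a, b; split=> //; apply/negP.
have [m mb] := not_injective_misses ninj.
have actV u : act d u \in perm_powers s :|: orbit_merging s a b m.
  apply: act_in => [|f x fV]; first by rewrite in_setU id_perm_powers.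
  case: (dx x) => dE.
    by rewrite (_ : [ffun z => _] = [ffun z => s (f z)]) ?mixed_perm //; apply/ffunP => z; rewrite !ffunE dE.
  by rewrite (_ : [ffun z => _] = [ffun z => beta (f z)]) ?mixed_beta //; apply/ffunP => z; rewrite !ffunE dE.
have [le_mu|[W [VW Wmu bW]]] := mixed_bound s m ab.
  apply: leq_trans le_mu; rewrite -[X in _ <= X]subn0 -(cards0 {ffun 'I_n -> 'I_n}).
  apply: (sc_root_le hL LF (kappa := id) actV); first exact: sub0set.
  by move=> f; rewrite inE.
have n1 : 1 < n by lia.
have [x [kappa kP]] := descents_redundant q0 F n1 bW.
apply: (@leq_trans (#|W| - #|descents x|)); last by rewrite card_descents // leq_sub2r.
apply: (sc_root_le hL LF (kappa := kappa)) => // [u|]; first exact: subsetP VW _ (actV u).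
by apply/subsetP => _ /imsetP[p _ ->].
Qed.

Lemma sc_root_le_card (W : {set {ffun 'I_n -> 'I_n}}) :
  (forall u, act d u \in W) -> sc (root_lang L) (regular_root hL) <= #|W|.
Proof.
move=> actW; rewrite -[X in _ <= X]subn0 -(cards0 {ffun 'I_n -> 'I_n}).
by apply: (sc_root_le hL LF (kappa := id) actW); [exact: sub0set | move=> f; rewrite inE].
Qed.

Lemma sc_root_upper : #|Sigma| = 2 -> sc (root_lang L) (regular_root hL) <= mu - 'C(n, 2).
Proof.
move=> S2.
have [x [y [xy xyP]]] : exists x y : Sigma, x != y /\ forall z : Sigma, z = x \/ z = y.
  have /card_gt1P[x [y [_ _ xy]]] : 1 < #|Sigma| by rewrite S2.
  exists x, y; split=> // z.
  have := subset_cardP (_ : #|[set x; y]| = #|Sigma|).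
  rewrite cards2 xy S2 => /(_ erefl (subset_predT _) z).
  by rewrite !inE => /orP[]/eqP; [left|right].
have [ix|nx] := pselect (injective (d^~ x)); have [iy|ny] := pselect (injective (d^~ y)).
- apply: (@leq_trans #|[set f : {ffun 'I_n -> 'I_n} | injectiveb f]|).
    apply: sc_root_le_card; apply: act_in => [|f c].
      by rewrite inE; apply/injectiveP => u v; rewrite !ffunE.
    rewrite !inE => /injectiveP fi; apply/injectiveP => u v; rewrite !ffunE.
    by case: (xyP c) => -> => [/ix/fi|/iy/fi].
  rewrite card_injective; apply: leq_trans (leq_mu_subC2 bound_exp); exact: leq_addr.
- apply: (sc_root_mixed (s := perm ix) ny) => z.
  by case: (xyP z) => ->; [left => u; rewrite permE | right].
- apply: (sc_root_mixed (s := perm iy) nx) => z.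
  by case: (xyP z) => ->; [right | left => u; rewrite permE].
have [mx mxP] := not_injective_misses nx; have [my myP] := not_injective_misses ny.
pose M m := [set f : {ffun 'I_n -> 'I_n} | m \notin codom f].
(* Neither letter is injective: a nonempty word misses the point that its last letter misses. *)
pose W := [ffun z => z] |: (M mx :|: M my).
apply: (@leq_trans #|W|).
  apply: sc_root_le_card; apply: act_in => [|f c _]; first exact: setU11.
  rewrite !inE; apply/orP; right.
  by case: (xyP c) => ->; apply/orP; [left|right]; apply/negP => /codomP[z]; rewrite ffunE => /esym/eqP;
    rewrite ?(negPf (mxP _)) ?(negPf (myP _)).
apply: leq_trans (leq_mu_subC2 bound_exp); rewrite cardsU1.
apply: leq_add; first by apply: (leq_trans (leq_b1 _)); exact: fact_gt0.
apply: (leq_trans (leq_card_setU _ _).1).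
by rewrite !card_misses_ord mul2n addnn.
Qed.

End Root.
End Letters.

(** * Permutations *)

(** Conjugating the transposition of [x] and [c] by elements fixing [c] gives every transposition of
    [c] with a point other than [j], and these generate the stabilizer of [j]. *)
Lemma perm_in_star (T : finType) (G : {group {perm T}}) (c x j : T) :
  tperm x c \in G -> c != j ->
  (forall y, y != c -> y != j -> exists2 u, u \in G & u c = c /\ u x = y) ->
  forall s : {perm T}, s j = j -> s \in G.
Proof.
move=> xcG cj reach.
have starG y : y != j -> tperm y c \in G.
  move=> yj; have [->|yc] := eqVneq y c; first by rewrite tperm1 group1.
  have [u uG [uc ux]] := reach y yc yj.
  by rewrite -ux -{1}uc -tpermJ groupJ.
have tpermG y z : y != j -> z != j -> tperm y z \in G.
  move=> yj zj; have [->|yc] := eqVneq y c; first by rewrite tpermC starG.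
  have [->|yz] := eqVneq y z; first by rewrite tperm1 group1.
  have -> : tperm y z = (tperm y c ^ tperm z c)%g.
    by rewrite tpermJ tpermR tpermD // eq_sym.
  by rewrite groupJ ?starG.
(* Induction on the number of moved points: composing with the transposition of [z] and [s z] makes
   [z] fixed. *)
move=> s; move: {2}#|_| (leqnn #|[set z | s z != z]|) => N.
elim: N s => [|N IH] s sN sj.
  suff -> : s = 1%g by rewrite group1.
  apply/permP => z; rewrite perm1; apply/eqP; apply: contraTT sN => sz.
  by rewrite -ltnNge card_gt0; apply/set0Pn; exists z; rewrite inE.
have [->|/eqP/permP s1] := eqVneq s 1%g; first exact: group1.
have [z sz] : exists z, s z != z.
  by apply: contrapT => no; apply: s1 => z; rewrite perm1; apply/eqP; apply: contrapT => /negP sz; apply: no; exists z.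
have zj : z != j by apply: contraNneq sz => ->; rewrite sj.
have szj : s z != j by apply: contraNneq zj => szj; rewrite -(inj_eq (@perm_inj _ s)) sj szj.
pose t := tperm (s z) z.
have sE : s = ((s * t) * t)%g by rewrite -mulgA tperm2 mulg1.
rewrite sE groupM ?tpermG //; apply: IH; last by rewrite permM sj tpermD.
rewrite -ltnS; apply: leq_trans sN; apply: proper_card; apply/properP; split.
  apply/subsetP => w; rewrite !inE permM; apply: contra => /eqP sw; rewrite sw tpermD //.
    by apply: contra sz => /eqP szw; rewrite szw -(inj_eq (@perm_inj _ s)) szw sw.
  by apply: contra sz => /eqP zw; rewrite zw sw.
by exists z; rewrite !inE // permM tpermL eqxx.
Qed.

Section CyclePerm.
Variables (T : finType) (c : seq T) (uc : uniq c).

Definition cycle_perm : {perm T} := perm (can_inj (prev_next uc)).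

Lemma cycle_permE z : cycle_perm z = next c z.
Proof. by rewrite permE. Qed.

Lemma cycle_perm_out z : z \notin c -> cycle_perm z = z.
Proof. by move=> zc; rewrite cycle_permE next_nth (negPf zc). Qed.

Lemma cycle_perm_reach x y : x \in c -> y \in c -> exists i, (cycle_perm ^+ i)%g x = y.
Proof.
move=> xc yc; have : fconnect (next c) x y by rewrite (fconnect_cycle (cycle_next uc) xc).
move/iter_findex => <-; exists (findex (next c) x y).
by rewrite permX; apply: eq_iter => z; rewrite cycle_permE.
Qed.

Lemma cycle_perm_expg : (cycle_perm ^+ size c = 1)%g.
Proof.
apply/permP => z; rewrite permX perm1 (eq_iter cycle_permE).
have [zc|zc] := boolP (z \in c).
  by rewrite -(order_cycle (cycle_next uc) uc zc) iter_order //; apply: can_inj (prev_next uc).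
by elim: (size c) => //= i ->; rewrite next_nth (negPf zc).
Qed.

End CyclePerm.

Section Rotation.
Variables (k l : nat) (kl : coprime k l).
Let T := 'I_(k + l).

Definition rot_perm : {perm T} := perm (@alpha_inj k l).

Lemma iter_alpha_lshift m (i : 'I_k) : val (iter m (@alpha k l) (lshift l i)) = (i + m) %% k.
Proof.
elim: m => [|m IH] /=; first by rewrite addn0 modn_small.
rewrite /alpha; case: split_ordP IH => j -> /= IH; last first.
  have : (i + m) %% k < k by rewrite ltn_mod; exact: leq_ltn_trans (ltn_ord i).
  by rewrite -IH ltnNge leq_addr.
by rewrite IH addnS -addn1 modnDml addn1.
Qed.

Lemma iter_alpha_rshift m (j : 'I_l) : val (iter m (@alpha k l) (rshift k j)) = k + (j + m) %% l.
Proof.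
elim: m => [|m IH] /=; first by rewrite addn0 modn_small.
rewrite /alpha; case: split_ordP IH => i -> /= IH.
  by have := ltn_ord i; rewrite IH ltnNge leq_addr.
by move/addnI: IH => ->; rewrite addnS -addn1 modnDml addn1.
Qed.

(** By the Chinese remainder theorem the two cycles can be rotated by independent amounts; [k - i]
    replaces a subtraction of i modulo k. *)
Lemma rot_perm_align (i i' : 'I_k) (j j' : 'I_l) : exists m,
  (rot_perm ^+ m)%g (lshift l i) = lshift l i' /\ (rot_perm ^+ m)%g (rshift k j) = rshift k j'.
Proof.
exists (chinese k l (i' + (k - i)) (j' + (l - j))).
rewrite !permX !(eq_iter (permE (@alpha_inj k l))); split; apply: val_inj.
  rewrite iter_alpha_lshift -modnDmr chinese_modl // modnDmr /= addnCA subnKC ?(ltnW (ltn_ord i)) //.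
  by rewrite modnDr modn_small.
rewrite iter_alpha_rshift -modnDmr chinese_modr // modnDmr /= addnCA subnKC ?(ltnW (ltn_ord j)) //.
by rewrite modnDr modn_small.
Qed.

Lemma rot_perm_left (i i' : 'I_k) : exists m,
  (rot_perm ^+ m)%g (lshift l i) = lshift l i' /\
  forall j : 'I_l, (rot_perm ^+ m)%g (rshift k j) = rshift k j.
Proof.
exists (chinese k l (i' + (k - i)) 0).
split=> [|j]; rewrite !permX !(eq_iter (permE (@alpha_inj k l))); apply: val_inj.
  rewrite iter_alpha_lshift -modnDmr chinese_modl // modnDmr /= addnCA subnKC ?(ltnW (ltn_ord i)) //.
  by rewrite modnDr modn_small.
by rewrite iter_alpha_rshift -modnDmr chinese_modr // mod0n addn0 modn_small.
Qed.

End Rotation.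

(** * Two generators of U *)

Section Generation.
Variables (k l : nat) (kl : coprime k l) (k2 : 2 <= k) (l3 : 3 <= l).
Let T := 'I_(k + l).
Let Q : {set T} := [set z : T | k <= z].
Let rot : {perm T} := rot_perm k l.

(** For distinct [i] and [j] this merges only these two points and misses only [s j]; every map of
    corank 1 merging [i] and [j] arises so. *)
Definition redirect (i j : T) (s : {perm T}) : {ffun T -> T} :=
  [ffun z => s (if z == j then i else z)].

Lemma lshiftP (z : T) : z \notin Q -> exists i, z = lshift l i.
Proof. by rewrite inE -ltnNge; case: split_ordP => // i -> _; exists i. Qed.

Lemma rshiftP (z : T) : z \in Q -> exists j, z = rshift k j.
Proof. by rewrite inE leqNgt; case: split_ordP => // j -> _; exists j. Qed.

Lemma lshiftQ (i : 'I_k) : lshift l i \notin Q.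
Proof. by rewrite inE -ltnNge /=. Qed.

Lemma rshiftQ (j : 'I_l) : rshift k j \in Q.
Proof. by rewrite inE /= leq_addr. Qed.

Lemma cardQ : #|Q| = l.
Proof.
rewrite -[RHS]card_ord -(card_imset predT (@rshift_inj k l)); apply: eq_card => z.
apply/idP/imsetP => [/rshiftP[j ->]|[j _ ->]]; [by exists j | exact: rshiftQ].
Qed.

Lemma rot_pow_Q m z : ((rot ^+ m)%g z \in Q) = (z \in Q).
Proof.
elim: m => [|m IH]; first by rewrite perm1.
rewrite expgSr permM -IH permE; move: ((rot ^+ m)%g z) => y.
by rewrite /alpha; case: split_ordP => i ->; rewrite ?rshiftQ // !(negPf (lshiftQ _)).
Qed.

Lemma align i i' j j' : i \notin Q -> i' \notin Q -> j \in Q -> j' \in Q ->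
  exists m, (rot ^+ m)%g i = i' /\ (rot ^+ m)%g j = j'.
Proof.
move=> /lshiftP[a ->] /lshiftP[a' ->] /rshiftP[b ->] /rshiftP[b' ->].
exact: rot_perm_align.
Qed.

Section Closure.
Variable gen : {ffun T -> T} -> Prop.
Hypothesis gen_comp : forall f g : {ffun T -> T}, gen f -> gen g -> gen [ffun z => g (f z)].
Hypothesis gen_rot : gen (finfun (@alpha k l)).
Hypothesis gen_id : gen [ffun z => z].

Lemma gen_rot_pow m : gen (finfun (fun_of_perm (rot ^+ m)%g)).
Proof.
elim: m => [|m IH].
  by rewrite (_ : finfun _ = [ffun z => z]) //; apply/ffunP => z; rewrite !ffunE perm1.
rewrite (_ : finfun _ = [ffun z => finfun (@alpha k l) (finfun (fun_of_perm (rot ^+ m)%g) z)]).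
  exact: gen_comp.
by apply/ffunP => z; rewrite !ffunE expgSr permM permE.
Qed.

Section Redirect.
Variables (i0 j0 : T) (s0 : {perm T}).
Hypotheses (i0Q : i0 \notin Q) (j0Q : j0 \in Q) (s0j0 : s0 j0 = j0).
Hypothesis gen_s0 : gen (redirect i0 j0 s0).

Let i0j0 : i0 != j0. Proof. by apply: contraNneq i0Q => ->. Qed.

Definition local_perms := [set s : {perm T} | (s j0 == j0) && `[< gen (redirect i0 j0 s) >]].

(** A map [redirect i0 j0 s] with [s] fixing [j0] never takes the value [j0], so the second
    redirection has no effect and the permutations multiply. *)
Lemma local_permsM s t : s \in local_perms -> t \in local_perms -> (s * t)%g \in local_perms.
Proof.
rewrite !inE => /andP[/eqP sj /asboolP gs] /andP[/eqP tj /asboolP gt].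
rewrite permM sj tj eqxx; apply/asboolP.
rewrite (_ : redirect _ _ _ = [ffun z => redirect i0 j0 t (redirect i0 j0 s z)]); first exact: gen_comp.
have sne w : w != j0 -> (s w == j0) = false.
  by move=> wj; apply: contraNF wj => /eqP E; rewrite -(inj_eq (@perm_inj _ s)) sj E.
by apply/ffunP => z; rewrite !ffunE permM; case: (eqVneq z j0) => [_|/sne->//]; rewrite sne.
Qed.

Lemma local_perms_s0 : s0 \in local_perms.
Proof. by rewrite inE s0j0 eqxx; apply/asboolP. Qed.

Lemma local_perms_group : group_set local_perms.
Proof.
apply/group_setP; split; last exact: local_permsM.
have pow m : (s0 ^+ m.+1)%g \in local_perms.
  elim: m => [|m IH]; first by rewrite expg1 local_perms_s0.
  by rewrite expgS local_permsM // local_perms_s0.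
by have := pow (#[s0]%g).-1; rewrite prednK // expg_order.
Qed.

Canonical local_group := Group local_perms_group.

Lemma local_rot m : (forall j : 'I_l, (rot ^+ m)%g (rshift k j) = rshift k j) ->
  (rot ^+ m)%g \in local_perms.
Proof.
move=> fixQ; have := group1 local_group; rewrite !inE => /andP[_ /asboolP g1].
have [j jE] := rshiftP j0Q; rewrite {1}jE fixQ -jE eqxx; apply/asboolP.
rewrite (_ : redirect _ _ _ = [ffun z => finfun (fun_of_perm (rot ^+ m)%g) (redirect i0 j0 1%g z)]).
  exact: gen_comp g1 (gen_rot_pow m).
by apply/ffunP => z; rewrite !ffunE perm1.
Qed.

Hypothesis full : forall s : {perm T}, s j0 = j0 -> s \in local_perms.

(** Rotations before and after reduce to [i0], [j0] and a permutation fixing [j0]. *)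
Lemma gen_redirect (i j : T) (s : {perm T}) : i \notin Q -> j \in Q -> s j \in Q -> gen (redirect i j s).
Proof.
move=> iQ jQ sjQ.
have [m [mi mj]] := align iQ i0Q jQ j0Q.
have [m' [_ mj']] := align i0Q i0Q j0Q sjQ.
pose t := (rot ^- m * s * rot ^- m')%g.
have tj0 : t j0 = j0.
  by rewrite /t !permM -{1}mj permK -mj' permK.
have := full tj0; rewrite inE => /andP[_ /asboolP gt].
have -> : redirect i j s = [ffun z => finfun (fun_of_perm (rot ^+ m')%g)
   ([ffun z => redirect i0 j0 t (finfun (fun_of_perm (rot ^+ m)%g) z)] z)].
  apply/ffunP => z; rewrite !ffunE.
  have -> : ((rot ^+ m)%g z == j0) = (z == j) by rewrite -mj (inj_eq perm_inj).
  rewrite -mi.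
  by case: eqP => _; rewrite /t !permM permK permKV.
by apply: gen_comp (gen_rot_pow _); apply: gen_comp (gen_rot_pow _) gt.
Qed.

(** Induction on the number of missed points. A map injective off [j] is a [redirect]; any other map
    is a redirection followed by a map [g] that also reaches a missed point [z0], still misses [m]
    and still merges across [Q]. *)
Lemma gen_merging (f : {ffun T -> T}) i j m : i \notin Q -> j \in Q -> f i = f j ->
  m \in Q -> m \notin codom f -> gen f.
Proof.
move: {2}#|_| (leqnn #|[set z | z \notin codom f]|) => N.
elim: N f i j m => [|N IH] f i j m fN iQ jQ fij mQ mf.
  by move: fN; rewrite leqn0 cards_eq0 => /eqP/setP/(_ m); rewrite !inE mf.
have ij : i != j by apply: contraNneq iQ => ->.
have [fj_inj|no] := pselect (forall x y, x != j -> y != j -> f x = f y -> x = y).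
  pose r z := if z == j then m else f z.
  have rinj : injective r.
    have fm x : f x <> m by move=> E; rewrite -E codom_f in mf.
    move=> x y; rewrite /r; case: (eqVneq x j) => [->|xj]; case: (eqVneq y j) => [->|yj] //.
    - by move/esym/fm.
    - by move/fm.
    - exact: fj_inj.
  have -> : f = redirect i j (perm rinj).
    apply/ffunP => z; rewrite ffunE permE /r.
    by case: (eqVneq z j) => [->|/negPf->//]; rewrite (negPf ij).
  by apply: gen_redirect => //; rewrite permE /r eqxx.
have [x [y [[xj yj] [xy fxy]]]] : exists x y, (x != j /\ y != j) /\ (x != y /\ f x = f y).
  apply: contrapT => no'; apply: no => x y xj yj fxy; apply/eqP; apply: contrapT => /negP xy.
  by apply: no'; exists x, y.
have [z0 z0m z0f] : exists2 z0, z0 != m & z0 \notin codom f.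
  apply: contrapT => no'.
  have : [set~ m] \subset f @: (~: [set j; y]).
    apply/subsetP => z; rewrite !inE => zm.
    have /codomP[w ->] : z \in codom f by apply: contrapT => /negP zf; apply: no'; exists z.
    have [->|wj] := eqVneq w j.
      have [iy|iy] := eqVneq i y; last by rewrite -fij imset_f // !inE negb_or ij.
      by rewrite -fij iy -fxy imset_f // !inE negb_or xj.
    have [->|wy] := eqVneq w y; last by rewrite imset_f // !inE negb_or wj.
    by rewrite -fxy imset_f // !inE negb_or xj.
  move/subset_leq_card => /leq_trans/(_ (leq_imset_card _ _)).
  rewrite cardsC1 cardsCs setCK cards2 [j == y]eq_sym yj card_ord; lia.
have step (s : {perm T}) (u v : T) : u != j -> v != j -> f u = f v -> s j = j ->
    s u \notin Q -> s v \in Q -> gen f.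
  move=> uj vj fuv sj suQ svQ.
  pose g : {ffun T -> T} := [ffun z => if z == j then z0 else f ((s^-1)%g z)].
  have gE w : w != j -> g (s w) = f w.
    by move=> wj; rewrite ffunE -{1}sj (inj_eq perm_inj) (negPf wj) permK.
  have -> : f = [ffun z => g (redirect i j s z)].
    apply/ffunP => z; rewrite ffunE [redirect _ _ _ _]ffunE.
    by case: (eqVneq z j) => [->|/gE->//]; rewrite gE.
  apply: gen_comp; first by apply: gen_redirect; rewrite ?sj.
  have mg : m \notin codom g.
    apply/negP => /codomP[z]; rewrite ffunE; case: ifP => _ E; first by rewrite E eqxx in z0m.
    by rewrite E codom_f in mf.
  apply: (IH g (s u) (s v) m) => //; last by rewrite !gE.
  rewrite -ltnS; apply: leq_trans fN; apply: proper_card; apply/properP; split.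
    apply/subsetP => z; rewrite !inE; apply: contra => /codomP[w ->].
    have [->|/gE<-] := eqVneq w j; last exact: codom_f.
    by rewrite -fij -gE // codom_f.
  exists z0; rewrite inE // negbK; apply/codomP; exists j; by rewrite ffunE eqxx.
have [xQ|xQ] := boolP (x \in Q); have [yQ|yQ] := boolP (y \in Q).
- have xi : i != x by apply: contraNneq iQ => ->.
  have yi : i != y by apply: contraNneq iQ => ->.
  by apply: (step (tperm x i) x y) => //; rewrite ?tpermL // tpermD // eq_sym.
- by apply: (step 1%g y x); rewrite ?perm1.
- by apply: (step 1%g x y); rewrite ?perm1.
have [q qQ qj] : exists2 q, q \in Q & q != j.
  have /card_gt0P[q] : 0 < #|Q :\ j|.
    have : 2 < #|Q| by rewrite cardQ.
    by rewrite (cardsD1 j Q); case: (j \in Q); case: #|_|.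
  by rewrite !inE => /andP[? ?]; exists q; rewrite ?inE.
have xq : q != x by apply: contraNneq xQ => <-.
apply: (step (tperm y q) x y) => //; rewrite ?tpermL // tpermD // eq_sym //.
Qed.

Lemma gen_U f : f \in U k l -> gen f.
Proof.
case/in_U => [[m [_ fm]]|[[i [j fij]] [m mf]]].
  rewrite (_ : f = finfun (fun_of_perm (rot ^+ m)%g)); first exact: gen_rot_pow.
  by apply/ffunP => z; rewrite ffunE fm permX; apply: eq_iter => x; rewrite permE.
apply: (gen_merging (lshiftQ i) (rshiftQ j) fij (rshiftQ m)).
by apply/negP => /codomP[z]; apply/eqP; rewrite eq_sym; apply/eqP.
Qed.

End Redirect.
End Closure.

(* A power of [s0] isolates the transposition, since the other factor has odd
   order; conjugating it by elements fixing [c] yields all [(y c)]. *)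
Lemma exists_second_generator : exists (i0 j0 : T) (s0 : {perm T}),
  [/\ i0 \notin Q, j0 \in Q, s0 j0 = j0 &
    forall G : {group {perm T}}, s0 \in G ->
      (forall m, (forall j : 'I_l, (rot ^+ m)%g (rshift k j) = rshift k j) -> (rot ^+ m)%g \in G) ->
      forall s : {perm T}, s j0 = j0 -> s \in G].
Proof.
have k0 : 0 < k by lia.
have l0 : 0 < l by lia.
have l1 : 1 < l by lia.
have kp : k.-1 < k by lia.
pose p0 : T := lshift l (Ordinal k0); pose p1 : T := lshift l (Ordinal k2).
pose pl : T := lshift l (Ordinal kp).
pose c : T := rshift k (Ordinal l0); pose j0 : T := rshift k (Ordinal l1).
have cj0 : c != j0 by rewrite (inj_eq (@rshift_inj k l)).
have PQ i j : lshift l i != rshift k j by rewrite eq_lrshift.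
(* For k = 2 the rotation fixing [Q] is itself the transposition of [p1] and [p0], and [s0] cycles
   [p1] through all points other than [p0] and [j0]. *)
have [k3|kle2] := leqP 3 k; last first.
  have p10 : p1 != p0 by rewrite (inj_eq (@lshift_inj k l)).
  have us : uniq (p1 :: enum (Q :\ j0)).
    by rewrite /= enum_uniq andbT mem_enum !inE negb_and /= -ltnNge k2 orbT.
  have j0s : j0 \notin p1 :: enum (Q :\ j0).
    by rewrite inE negb_or mem_enum !inE eqxx /= eq_sym PQ.
  have p0s : p0 \notin p1 :: enum (Q :\ j0).
    by rewrite inE negb_or mem_enum !inE eq_sym p10 /= negb_and -ltnNge k0 orbT.
  exists p0, j0, (cycle_perm us); split; [exact: lshiftQ | exact: rshiftQ | exact: cycle_perm_out |].
  move=> G sG rG; have [m [m0 mQ]] := rot_perm_left kl (Ordinal k0) (Ordinal k2).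
  have two (z : T) : z \notin Q -> z = p0 \/ z = p1.
    case/lshiftP => -[[|[|i]] ik] ->; last by lia.
      by left; apply: val_inj.
    by right; apply: val_inj.
  have tE : (rot ^+ m)%g = tperm p1 p0.
    apply/permP => z; have [/rshiftP[j ->]|zQ] := boolP (z \in Q).
      by rewrite mQ tpermD // PQ.
    case: (two z zQ) => ->; first by rewrite m0 tpermR.
    rewrite tpermL; case: (two ((rot ^+ m)%g p1)) => //; first by rewrite rot_pow_Q lshiftQ.
    have m0' : (rot ^+ m)%g p0 = p1 by [].
    by rewrite -{2}m0' => /perm_inj/eqP; rewrite (negPf p10).
  apply: (@perm_in_star _ G p0 p1 j0); [by rewrite -tE rG | exact: PQ |].
  move=> y yp0 yj0; have ys : y \in p1 :: enum (Q :\ j0).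
    rewrite inE mem_enum in_setD1 yj0; have [//|yQ] := boolP (y \in Q); first by rewrite orbT.
    by case: (two y yQ) => yE; rewrite yE ?eqxx // in yp0 *.
  have [i iE] := cycle_perm_reach us (mem_head _ _) ys.
  exists (cycle_perm us ^+ i)%g; rewrite ?groupX //; split=> //.
  by elim: (i) => [|n IH]; rewrite ?perm1 // expgSr permM IH cycle_perm_out.
(* As [E] has l - 2 points, one or two points of the first cycle are added to make the length of the
   cycle [rho] odd; [pl] and [c] stay outside, so [rho] commutes with their transposition. *)
pose ps := if odd l then [:: p0; p1] else [:: p0].
pose E := enum (Q :\ c :\ j0).
have p01 : p0 != p1 by rewrite (inj_eq (@lshift_inj k l)).
have psP z : z \in ps -> z \notin Q /\ z != pl.
  have hp0 : p0 \notin Q /\ p0 != pl.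
    by split; [exact: lshiftQ | apply/eqP => /(congr1 val) /=; lia].
  have hp1 : p1 \notin Q /\ p1 != pl.
    by split; [exact: lshiftQ | apply/eqP => /(congr1 val) /=; lia].
  rewrite /ps; case: ifP => _; last by rewrite mem_seq1 => /eqP->.
  by rewrite mem_seq2 => /orP[] /eqP->.
have us : uniq (ps ++ E).
  rewrite cat_uniq enum_uniq andbT; apply/andP; split.
    by rewrite /ps; case: ifP => //= _; rewrite inE p01.
  apply/hasPn => z; rewrite mem_enum !in_setD1 => /and3P[_ _ zQ].
  by apply/negP => /psP[]; rewrite zQ.
have plQ : pl \notin Q by exact: lshiftQ.
have pls : pl \notin ps ++ E.
  rewrite mem_cat negb_or mem_enum !in_setD1 (negPf plQ) !andbF andbT.
  by apply/negP => /psP[_]; rewrite eqxx.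
have cs : c \notin ps ++ E.
  rewrite mem_cat negb_or mem_enum !in_setD1 eqxx !andbF andbT.
  by apply/negP => /psP[]; rewrite rshiftQ.
have j0s : j0 \notin ps ++ E.
  rewrite mem_cat negb_or mem_enum !in_setD1 eqxx !andFb andbT.
  by apply/negP => /psP[]; rewrite rshiftQ.
have p0s : p0 \in ps ++ E by rewrite mem_cat /ps; case: ifP => _; rewrite inE eqxx.
have os : odd (size (ps ++ E)).
  have sE : size E = l - 2.
    rewrite -cardE; have := cardsD1 c Q; have := cardsD1 j0 (Q :\ c).
    rewrite in_setD1 [j0 == c]eq_sym cj0 !rshiftQ cardQ /=.
    by move: #|_ :\ j0| #|Q :\ c| => u v; lia.
  by rewrite size_cat sE /ps; case: ifP => ol /=; lia.
pose rho := cycle_perm us; pose t := tperm pl c.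
exists p0, j0, (t * rho)%g; split; [exact: lshiftQ | exact: rshiftQ | |].
  by rewrite permM (tpermD (PQ _ _ : pl != j0) cj0) cycle_perm_out.
move=> G sG rG.
have ct : commute t rho.
  by rewrite /commute conjgC tpermJ !cycle_perm_out.
have tG : t \in G.
  have <- : ((t * rho) ^+ size (ps ++ E))%g = t; last exact: groupX.
  rewrite expgMn // cycle_perm_expg mulg1 -[size _]odd_double_half os expgD expg1.
  by rewrite -mul2n expgM [(t ^+ 2)%g]tperm2 expg1n mulg1.
have rhoG : rho \in G by rewrite -(groupMl _ tG).
apply: (@perm_in_star _ G c pl j0) => // y yc yj0.
have [yQ|/lshiftP[i ->]] := boolP (y \in Q); last first.
  have [m [mi mQ]] := rot_perm_left kl (Ordinal kp) i.
  by exists (rot ^+ m)%g; [exact: rG | split; [exact: mQ | exact: mi]].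
have ys : y \in ps ++ E by rewrite mem_cat mem_enum !in_setD1 yc yj0 yQ orbT.
have [i iE] := cycle_perm_reach us p0s ys.
have [m [mi mQ]] := rot_perm_left kl (Ordinal kp) (Ordinal k0).
exists (rot ^+ m * rho ^+ i)%g; first by apply: groupM; [exact: rG | exact: groupX].
have mc : (rot ^+ m)%g c = c by exact: mQ.
have mp : (rot ^+ m)%g pl = p0 by exact: mi.
rewrite !permM mc mp iE; split=> //.
by elim: (i) => [|n IH]; rewrite ?perm1 // expgSr permM IH cycle_perm_out.
Qed.

End Generation.

(** * Tightness *)

Section Distinguish.
Variables (k l : nat) (k2 : 2 <= k) (l3 : 3 <= l).
Let T := 'I_(k + l).
Variable q0 : T.
Let acc := accepts q0 (pred1 q0).

Lemma bump_at_U (x a b : T) : bump_at x a b \in U k l.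
Proof.
apply/in_U; right.
pose P := [set z : T | z < k].
have cP : #|P| = k.
  rewrite -[RHS]card_ord -(card_imset predT (@lshift_inj k l)); apply: eq_card => z.
  rewrite inE; apply/idP/imsetP => [|[i _ ->]]; last exact: (ltn_ord i).
  by case: split_ordP => // i -> _; exists i.
have cPC : #|~: P| = l.
  by apply/eqP; rewrite -(eqn_add2l #|P|) cardsC card_ord cP.
have bP : bump_at x a b \in merging P by apply: bump_at_merging; rewrite ?cP ?cPC.
have phiP (z : T) : (z \in P) = (z < k) by rewrite inE.
have := @conj_merging _ k l id id (fun=> erefl) P phiP _ bP.
by rewrite (_ : conj _ _ _ = bump_at x a b) //; apply/ffunP => z; rewrite ffunE.
Qed.

(** The test map sends [f q0] to [q0] and all else to [c]. After [f] it accepts at once; after [g]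
    it is trapped at [c] unless g(c) = f(q0). *)
Lemma distinguish_start (f g : {ffun T -> T}) : f q0 != g q0 ->
  (forall h, h \in U k l -> acc (h \o f) <-> acc (h \o g)) ->
  g = bump_at q0 (f q0) (g q0).
Proof.
move=> fg eq_acc; apply/ffunP => c; rewrite ffunE; case: eqVneq => [->//|cq].
apply: contrapT => /eqP gc.
have [] := eq_acc _ (bump_at_U (f q0) c q0) => + _.
case=> [|m]; first by exists 0; rewrite /= ffunE eqxx.
suff -> : iter m.+1 (bump_at (f q0) c q0 \o g) q0 = c by rewrite /= (negPf cq).
elim: m => [|m IH]; first by rewrite /= ffunE eq_sym (negPf fg).
by rewrite iterS IH /= ffunE (negPf gc).
Qed.

(** The test map sends [f x] to [q0] and all else to [x]: after [f] the orbit is [q0], [x], [q0],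
    after [g] it stays at [x]. *)
Lemma distinguish_other (f g : {ffun T -> T}) x : f q0 = g q0 -> x != q0 ->
  f x != f q0 -> f x != g x -> 
  exists2 h, h \in U k l & acc (h \o f) /\ ~ acc (h \o g).
Proof.
move=> fg0 xq fx fgx; exists (bump_at (f x) x q0); first exact: bump_at_U.
split; first by exists 1; rewrite /= /bump_at !ffunE [f q0 == _]eq_sym (negPf fx) eqxx.
case=> m; suff -> : iter m.+1 (bump_at (f x) x q0 \o g) q0 = x by rewrite /= (negPf xq).
elim: m => [|m IH]; first by rewrite /= ffunE -fg0 eq_sym (negPf fx).
by rewrite iterS IH /= ffunE eq_sym (negPf fgx).
Qed.

(** If [f] and [g] differ at [q0], they are the two orders of one pair, and one of them is in
    [descents q0]. Otherwise, where they differ, one of them departs from their common value at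
    [q0]. *)
Lemma distinguish (f g : {ffun T -> T}) :
  f \notin descents q0 -> g \notin descents q0 ->
  (forall h, h \in U k l -> acc (h \o f) <-> acc (h \o g)) -> f = g.
Proof.
move=> fD gD eq_acc; have [fg0|fg0] := eqVneq (f q0) (g q0); last first.
  have gE := distinguish_start fg0 eq_acc.
  have fE : f = bump_at q0 (g q0) (f q0).
    by apply: distinguish_start => [|h /eq_acc[? ?]//]; rewrite eq_sym.
  have desc (a b : T) : b < a -> bump_at q0 a b \in descents q0.
    by move=> ba; apply/imsetP; exists (a, b); rewrite ?inE.
  case: (ltngtP (f q0) (g q0)) => [lt|lt|/val_inj eq].
  - by rewrite fE desc in fD.
  - by rewrite gE desc in gD.
  - by rewrite eq eqxx in fg0.
apply/ffunP => x; apply: contrapT => /eqP fgx.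
have xq : x != q0 by apply: contraNneq fgx => ->; rewrite fg0.
have [fx|fx] := eqVneq (f x) (f q0).
  have gx : g x != g q0 by rewrite -fg0 -fx eq_sym.
  have gfx : g x != f x by rewrite eq_sym.
  have [h hU [ag af]] := distinguish_other (esym fg0) xq gx gfx.
  by apply: af; apply/(eq_acc h hU).
have [h hU [af ag]] := distinguish_other fg0 xq fx fgx.
by apply: ag; apply/(eq_acc h hU).
Qed.

End Distinguish.

Lemma exists_tight_language k l n : coprime k l -> 2 <= k -> 3 <= l -> k + l = n ->
  exists (L : language bool) (hL : regular L),
    sc L hL <= n /\ #|U k l| - 'C(n, 2) <= sc (root_lang L) (regular_root hL).
Proof.
move=> kl k2 l3 <-.
have [i0 [j0 [s0 [i0Q j0Q sj0 full]]]] := exists_second_generator kl k2 l3.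
pose beta := redirect i0 j0 s0.
pose d (z : 'I_(k + l)) (x : bool) := if x then alpha z else beta z.
pose gen (f : {ffun 'I_(k + l) -> 'I_(k + l)}) := exists u, act d u = f.
have gen_comp f g : gen f -> gen g -> gen [ffun z => g (f z)].
  by move=> [u <-] [v <-]; exists (u ++ v); apply/ffunP => z; rewrite act_cat [RHS]ffunE.
have gen_rot : gen (finfun (@alpha k l)).
  by exists [:: true]; apply/ffunP => z; rewrite !ffunE.
have gen_beta : gen beta by exists [:: false]; apply/ffunP => z; rewrite ffunE.
have gen_id : gen [ffun z => z] by exists [::]; apply/ffunP => z; rewrite !ffunE.
have genU f : f \in U k l -> gen f.
  apply: (gen_U kl k2 l3 gen_comp gen_rot gen_id i0Q j0Q) => s sj.
  apply: (full (local_group gen_comp i0Q j0Q sj0 gen_beta)) sj.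
    exact: local_perms_s0.
  by move=> m; apply: (local_rot gen_comp gen_rot gen_id i0Q j0Q sj0 gen_beta).
pose q0 := i0.
pose M := @Dfa bool 'I_(k + l) q0 (pred1 q0) d.
pose L : language bool := fun w => dfa_final (foldl (@dfa_trans _ M) (dfa_start M) w).
have ML : recognizes M L by [].
have hL : regular L by exists M.
exists L, hL; split; first by rewrite (leq_trans (sc_le_states hL ML)) // card_ord.
(* The empty word is a default outside the generated monoid; it is never reached on [U k l]. *)
pose word (f : {ffun 'I_(k + l) -> 'I_(k + l)}) : seq bool :=
  if pselect (gen f) is left h then projT1 (cid h) else [::].
have wordK f : f \in U k l -> act d (word f) = f.
  by move=> /genU gf; rewrite /word; case: pselect => // h; case: cid.
apply: (@leq_trans #|U k l :\: descents q0|).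
  rewrite -(@card_descents _ q0); last lia.
  by rewrite cardsD leq_sub2l // subset_leq_card // subsetIr.
apply: (card_le_sc (regular_root hL) (word := word)) => f g.
rewrite !in_setD => /andP[fD fU] /andP[gD gU] fg.
have LF w : L w <-> pred1 q0 (foldl d q0 w) by [].
have accE e h : e \in U k l -> h \in U k l ->
    root_lang L (word e ++ word h) <-> accepts q0 (pred1 q0) (h \o e).
  move=> eU hU; rewrite (root_lang_accepts LF).
  by split; apply: eq_accepts => z; rewrite act_cat !wordK.
by apply: (distinguish k2 l3 fD gD) => h hU; rewrite -!accE.
Qed.

Theorem corollary3p24 (n : nat) (hn : prime n) (hn7 : 7 <= n) :
  exists k l : nat,
    [/\ 2 <= k, 3 <= l, coprime k l & k + l = n] /\
    (forall Sigma : finType, #|Sigma| = 2 ->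
       forall (L : language Sigma) (hL : regular L),
         sc L hL <= n ->
         sc (root_lang L) (regular_root hL) <= #|U k l| - 'C(n, 2)) /\
    (exists Sigma : finType, #|Sigma| = 2 /\
       exists (L : language Sigma) (hL : regular L),
         sc L hL <= n /\
         sc (root_lang L) (regular_root hL) = #|U k l| - 'C(n, 2)).
Proof.
pose ok (i : 'I_n) := (2 <= i) && (3 <= n - i).
have n2 : 2 < n by lia.
have ok0 : ok (Ordinal n2) by rewrite /ok /=; lia.
(* Maximizing over all admissible splittings lets one bound cover every cycle type; primality of n
   makes the two parts coprime. *)
pose k := [arg max_(i > Ordinal n2 | ok i) #|U i (n - i)|].
have [k2 l3 kmax] : [/\ 2 <= k, 3 <= n - k & forall i, ok i -> #|U i (n - i)| <= #|U k (n - k)|].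
  by rewrite /k; case: arg_maxnP => // i /andP[].
have kln : k + (n - k) = n by rewrite subnKC // ltnW.
have co : coprime k (n - k).
  rewrite /coprime -(gcdnDl k) kln gcdnC -/(coprime n k) prime_coprime //.
  by rewrite gtnNdvd //; lia.
have muP i j : 2 <= i -> 3 <= j -> i + j = n -> #|U i j| <= #|U k (n - k)|.
  move=> i2 j3 ijn; have i_n : i < n by lia.
  have jE : j = n - i by lia.
  by rewrite jE; apply: (kmax (Ordinal i_n)); rewrite /ok /= i2 -jE.
have upper (Sigma : finType) : #|Sigma| = 2 ->
    forall (L : language Sigma) (hL : regular L), sc L hL <= n ->
    sc (root_lang L) (regular_root hL) <= #|U k (n - k)| - 'C(n, 2).
  move=> S2 L hL /regular_ordinal[d [q0 [F LF]]].
  exact: (sc_root_upper hn hn7 muP hL LF S2).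
exists k, (n - k); split=> //; split=> //.
exists bool; split; first exact: card_bool.
have [L [hL [scL scR]]] := exists_tight_language co k2 l3 kln.
exists L, hL; split=> //.
by apply/eqP; rewrite eqn_leq upper ?card_bool.
Qed.
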